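(* (Composition-Diamond lemma for commutative dialgebras) Let $S$ be a monic subset of $Di[X]$, $>$ a monomial-center ordering on $\lfloor X^+\rfloor_1\cup\lfloor XX\rfloor_2$, and $Id(S)$ the ideal of $Di[X]$ generated by $S$. Then the following statements are equivalent. (i) $S$ is a Gröbner--Shirshov basis in $Di[X]$. (ii) If $0\neq f\in Id(S)$, then $\overline{f}=\overline{\lfloor sb\rfloor_m}$ for some normal $S$-polynomial $\lfloor sb\rfloor_m$. (iii) The set $Irr(S)=\{\lfloor a\rfloor_n\in \lfloor X^+\rfloor_1\cup\lfloor XX\rfloor_2 \mid \lfloor a\rfloor_n\neq\overline{\lfloor sb\rfloor_m}\text{ for any normal }S\text{-polynomial }\lfloor sb\rfloor_m\}$ is a $\mathbf{k}$-basis of the commutative dialgebra $Di[X|S]:=Di[X]/Id(S)$.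
   Context: Fix a field $\mathbf{k}$. A commutative dialgebra is a $\mathbf{k}$-linear space with two bilinear operations $\vdash,\dashv$, each associative and commutative, satisfying $a\dashv(b\vdash c)=a\dashv(b\dashv c)$, $(a\dashv b)\vdash c=(a\vdash b)\vdash c$, $a\vdash(b\dashv c)=(a\vdash b)\dashv c$. An ideal is a subspace closed under multiplication (by $\vdash$ and by $\dashv$) with arbitrary elements; $Id(S)$ is the ideal generated by $S$. Let $X$ be a totally ordered set, $\lfloor X^+\rfloor$ the free commutative semigroup without unit on $X$ (elements $\lfloor u\rfloor$, length $|u|$), $\lfloor X^*\rfloor=\lfloor X^+\rfloor\cup\{\varepsilon\}$ the free commutative monoid. Let $\lfloor X^+\rfloor_1=\{\lfloor u\rfloor_1\mid\lfloor u\rfloor\in\lfloor X^+\rfloor\}$ and $\lfloor XX\rfloor_2=\{\lfloor v\rfloor_2\mid\lfloor v\rfloor\in\lfloor X^+\rfloor,|v|=2\}$ (formal symbols); $x\in X$ is identified with $\lfloor x\rfloor_1$. $Di[X]$ is the free commutative dialgebra generated by $X$: the $\mathbf{k}$-space with basis $\lfloor X^+\rfloor_1\cup\lfloor XX\rfloor_2$ and operations: for $x,x'\in X$, $x\dashv x'=\lfloor xx'\rfloor_1$, $x\vdash x'=\lfloor xx'\rfloor_2$; and if $|uv|>2$, $\lfloor u\rfloor_p\vdash\lfloor v\rfloor_q=\lfloor u\rfloor_p\dashv\lfloor v\rfloor_q=\lfloor uv\rfloor_1$. Ordering. A monomial ordering on $\lfloor X^+\rfloor$ is a well (total) ordering with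 $\lfloor u\rfloor>\lfloor v\rfloor\Rightarrow\lfloor uw\rfloor>\lfloor vw\rfloor$. The associated monomial-center ordering on $\lfloor X^+\rfloor_1\cup\lfloor XX\rfloor_2$ is: $\lfloor u\rfloor_m>\lfloor v\rfloor_n$ iff $(\lfloor u\rfloor,m)>(\lfloor v\rfloor,n)$ lexicographically. For nonzero $f\in Di[X]$: $supp(f)$ is the set of basis elements occurring with nonzero coefficient; $\overline f$ its largest element (leading monomial), $lc(f)$ its coefficient; $\widetilde f\in\lfloor X^+\rfloor$ is the word $\lfloor u\rfloor$ if $\overline f=\lfloor u\rfloor_m$; $r_f=f-lc(f)\overline f$. Convention: $\overline 0=\widetilde 0=0$ is smaller than everything. $f$ is monic if $lc(f)=1$; a set is monic if all its elements are. $f\ne0$ is strong if $\widetilde f>\widetilde{r_f}$. Normal polynomials. For a monic set $S$ the normal $S$-polynomials (normal $s$-polynomials, $s\in S$) $\lfloor sb\rfloor_m$ ($\lfloor b\rfloor\in\lfloor X^*\rfloor$, $m\in\{1,2\}$) are: $\lfloor sb\rfloor_m=s$ if $b=\varepsilon$ ($m$ being the index of $\overline s$); $\lfloor sb\rfloor_2=s\vdash b$ if $|\widetilde s|=1$ and $b\in X$; $\lfloor sb\rfloor_1=s\dashv\lfloor b\rfloor_1$ if $s$ is strong and $\lfloor b\rfloor\in\lfloor X^+\rfloor$. Compositions of monic $f,g\in Di[X]$: (i) if $f$ is not strong, for each $x\in X$, $f\vdash x$ and $f\dashv x$ (multiplication compositions); (ii) if $f$ is strong, $|\widetilde f|>1$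 and $supp(f)\cap X\ne\emptyset$, for each $x\in X$, $(f\vdash x)-(f\dashv x)$ (special composition); (iii) if $f\neq g$, $\overline f=\overline g$: $f-g$ (equal composition); (iv) if $|\widetilde f|=2$, $|\widetilde g|=1$ and there is a normal $g$-polynomial $\lfloor gx\rfloor_m$, $x\in X$, with $\overline f=\overline{\lfloor gx\rfloor_m}$: $f-\lfloor gx\rfloor_m$ (short intersection composition); (v) if $f,g$ are strong, $|\widetilde f|+|\widetilde g|>3$, $\overline f\ne\overline g$: when $\widetilde f=\widetilde g$, for each $x\in X$, $\lfloor fx\rfloor_1-\lfloor gx\rfloor_1$ (equal multiplication composition); when $\widetilde f\neq\widetilde g$ and $lcm\{\widetilde f,\widetilde g\}=\lfloor w\rfloor=\lfloor\widetilde fa\rfloor=\lfloor\widetilde gb\rfloor$ with $\lfloor a\rfloor\in\lfloor X^*\rfloor$, $\lfloor b\rfloor\in\lfloor X^+\rfloor$, $|w|<|\widetilde f|+|\widetilde g|$: $\lfloor fa\rfloor_1-\lfloor gb\rfloor_1$ (long intersection composition). $h\in Di[X]$ is trivial modulo $S$ if $h=\sum_i\alpha_i\lfloor s_ib_i\rfloor_{m_i}$ (finite sum, $\alpha_i\in\mathbf{k}$, normal $S$-polynomials) with $\overline{\lfloor s_ib_i\rfloor_{m_i}}\le\overline h$ whenever $\alpha_i\ne0$. A monic set $S$ is a Gröbner--Shirshov basis in $Di[X]$ if every composition of polynomials in $S$ is trivial modulo $S$. *)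

(* Defs.v *)
From HB Require Import structures.
From mathcomp Require Import all_boot all_order all_algebra generic_quotient.
From mathcomp Require Import ring_quotient finmap monalg.
From mathcomp Require Import boolp classical_sets wochoice.

Set Implicit Arguments.
Unset Strict Implicit.
Unset Printing Implicit Defensive.

Import GRing.Theory Quotient.
Local Open Scope ring_scope.
Local Open Scope classical_set_scope.
Local Open Scope quotient_scope.

Reserved Notation "a ⊢ b" (at level 40, left associativity).
Reserved Notation "a ⊣ b" (at level 40, left associativity).

Local Notation "1" := (@mone _) : monom_scope.
Local Notation "u * v" := (mmul u v) : monom_scope.

HB.mixin Record Lmodule_isComDialgebra (k : fieldType) V
    & GRing.Lmodule k V := {
  vdash : V -> V -> V;
  dashv : V -> V -> V;
  vdash_linearl : forall b, linear (vdash^~ b);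
  vdash_linearr : forall a, linear (vdash a);
  dashv_linearl : forall b, linear (dashv^~ b);
  dashv_linearr : forall a, linear (dashv a);
  vdashA : associative vdash;
  dashvA : associative dashv;
  vdashC : commutative vdash;
  dashvC : commutative dashv;
  dashv_vdash : forall a b c, dashv a (vdash b c) = dashv a (dashv b c);
  vdash_dashv : forall a b c, vdash (dashv a b) c = vdash (vdash a b) c;
  vdash_dashvA : forall a b c, vdash a (dashv b c) = dashv (vdash a b) c
}.

#[short(type="comDialgType")]
HB.structure Definition ComDialgebra (k : fieldType) :=
  {V of GRing.Lmodule k V & Lmodule_isComDialgebra k V}.

Notation "a ⊢ b" := (vdash a b) : ring_scope.
Notation "a ⊣ b" := (dashv a b) : ring_scope.

Section Ideals.
Context {k : fieldType} {A : comDialgType k}.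
Implicit Types (I J S : set A) (a b : A).

Record is_ideal I : Prop := IsIdeal {
  ideal0 : I 0;
  idealD : forall a b, I a -> I b -> I (a + b);
  idealZ : forall (c : k) a, I a -> I (c *: a);
  ideal_vdashl : forall a b, I b -> I (a ⊢ b);
  ideal_vdashr : forall a b, I a -> I (a ⊢ b);
  ideal_dashvl : forall a b, I b -> I (a ⊣ b);
  ideal_dashvr : forall a b, I a -> I (a ⊣ b)
}.

Definition Id S : set A := [set f | forall J, is_ideal J -> S `<=` J -> J f].

Lemma Id_ideal S : is_ideal (Id S).
Proof.
split=> [J idJ _|a b Ia Ib J idJ sSJ|c a Ia J idJ sSJ|a b Ib J idJ sSJ
        |a b Ia J idJ sSJ|a b Ib J idJ sSJ|a b Ia J idJ sSJ].
- exact: ideal0.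
- by apply: idealD => //; [apply: Ia|apply: Ib].
- by apply: idealZ => //; apply: Ia.
- by apply: ideal_vdashl => //; apply: Ib.
- by apply: ideal_vdashr => //; apply: Ia.
- by apply: ideal_dashvl => //; apply: Ib.
- by apply: ideal_dashvr => //; apply: Ia.
Qed.

Lemma sub_Id S : S `<=` Id S.
Proof. by move=> f Sf J _; apply. Qed.

Definition Id_pred S : {pred A} := fun f => f \in Id S.

Lemma Id_predE S f : (f \in Id_pred S) = (f \in Id S).
Proof. by []. Qed.

Lemma Id_zmod_closed S : zmod_closed (Id_pred S).
Proof.
have idI := Id_ideal S.
split=> [|a b]; rewrite !Id_predE; first exact: (mem_set (ideal0 idI)).
move=> /set_mem Ia /set_mem Ib; apply: mem_set; apply: (idealD idI) => //.
by rewrite -(scaleN1r b); apply: (idealZ idI).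
Qed.

HB.instance Definition _ S :=
  GRing.isZmodClosed.Build A (Id_pred S) (Id_zmod_closed S).

End Ideals.

Definition dialg_quot (k : fieldType) (A : comDialgType k) (S : set A) :=
  {quot (Id_pred S)}.

Section QuotientDialgebra.
Context {k : fieldType} {A : comDialgType k} (S : set A).
Local Notation Q := (dialg_quot S).

HB.instance Definition _ := GRing.Zmodule.on Q.

Definition dialg_pi : A -> Q := \pi_{quot (Id_pred S)}.
Definition dialg_repr : Q -> A := @repr _ {quot (Id_pred S)}.

Lemma dialg_reprK x : dialg_pi (dialg_repr x) = x.
Proof. exact: (@reprK _ {quot (Id_pred S)}). Qed.

Lemma dialg_piP a b : reflect (Id S (a - b)) (dialg_pi a == dialg_pi b).
Proof. by rewrite -idealrBE Id_predE; apply: (iffP idP); rewrite inE. Qed.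

Lemma dialg_pi_eq a b : Id S (a - b) -> dialg_pi a = dialg_pi b.
Proof. by move/dialg_piP/eqP. Qed.

Lemma Id_reprB a : Id S (a - dialg_repr (dialg_pi a)).
Proof. by apply/dialg_piP; rewrite dialg_reprK. Qed.

Definition quot_scale (c : k) (x : Q) : Q := dialg_pi (c *: dialg_repr x).
Definition quot_vdash (x y : Q) : Q := dialg_pi (dialg_repr x ⊢ dialg_repr y).
Definition quot_dashv (x y : Q) : Q := dialg_pi (dialg_repr x ⊣ dialg_repr y).

Lemma vdashBl (a b c : A) : (a - b) ⊢ c = a ⊢ c - b ⊢ c.
Proof.
rewrite [a - b]addrC -(scaleN1r b) vdash_linearl.
by rewrite (scaleN1r (_ : A)) addrC.
Qed.
Lemma vdashBr (a b c : A) : a ⊢ (b - c) = a ⊢ b - a ⊢ c.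
Proof. by rewrite vdashC vdashBl !(vdashC a). Qed.
Lemma dashvBl (a b c : A) : (a - b) ⊣ c = a ⊣ c - b ⊣ c.
Proof.
rewrite [a - b]addrC -(scaleN1r b) dashv_linearl.
by rewrite (scaleN1r (_ : A)) addrC.
Qed.
Lemma dashvBr (a b c : A) : a ⊣ (b - c) = a ⊣ b - a ⊣ c.
Proof. by rewrite dashvC dashvBl !(dashvC a). Qed.

Lemma dialg_pi_scale c a : quot_scale c (dialg_pi a) = dialg_pi (c *: a).
Proof.
apply/esym/dialg_pi_eq; rewrite -scalerBr.
by apply: (idealZ (Id_ideal S)); apply: Id_reprB.
Qed.

Lemma dialg_pi_vdash a b : quot_vdash (dialg_pi a) (dialg_pi b) = dialg_pi (a ⊢ b).
Proof.
have idI := Id_ideal S; apply/esym/dialg_pi_eq.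
have -> : a ⊢ b - dialg_repr (dialg_pi a) ⊢ dialg_repr (dialg_pi b) =
    (a - dialg_repr (dialg_pi a)) ⊢ b + dialg_repr (dialg_pi a) ⊢ (b - dialg_repr (dialg_pi b)).
  by rewrite vdashBl vdashBr addrA subrK.
apply: (idealD idI).
  by apply: (ideal_vdashr idI); apply: Id_reprB.
by apply: (ideal_vdashl idI); apply: Id_reprB.
Qed.

Lemma dialg_pi_dashv a b : quot_dashv (dialg_pi a) (dialg_pi b) = dialg_pi (a ⊣ b).
Proof.
have idI := Id_ideal S; apply/esym/dialg_pi_eq.
have -> : a ⊣ b - dialg_repr (dialg_pi a) ⊣ dialg_repr (dialg_pi b) =
    (a - dialg_repr (dialg_pi a)) ⊣ b + dialg_repr (dialg_pi a) ⊣ (b - dialg_repr (dialg_pi b)).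
  by rewrite dashvBl dashvBr addrA subrK.
apply: (idealD idI).
  by apply: (ideal_dashvr idI); apply: Id_reprB.
by apply: (ideal_dashvl idI); apply: Id_reprB.
Qed.

Lemma dialg_pi_add a b : dialg_pi (a + b) = dialg_pi a + dialg_pi b.
Proof. exact: (@pi_addr _ _ _ _ _ {quot (Id_pred S)}). Qed.

Lemma quot_scaleA c d x :
  quot_scale c (quot_scale d x) = quot_scale (c * d) x.
Proof. by rewrite -[x]dialg_reprK !dialg_pi_scale scalerA. Qed.

Lemma quot_scale1 : left_id 1 quot_scale.
Proof. by move=> x; rewrite -[x]dialg_reprK dialg_pi_scale scale1r. Qed.

Lemma quot_scaleDr : right_distributive quot_scale +%R.
Proof.
move=> c x y; rewrite -[x]dialg_reprK -[y]dialg_reprK -dialg_pi_add !dialg_pi_scale.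
by rewrite scalerDr dialg_pi_add.
Qed.

Lemma quot_scaleDl x : {morph quot_scale^~ x : c d / c + d}.
Proof. by move=> c d; rewrite -[x]dialg_reprK !dialg_pi_scale scalerDl dialg_pi_add. Qed.

HB.instance Definition _ := GRing.Zmodule_isLmodule.Build k Q
  quot_scaleA quot_scale1 quot_scaleDr quot_scaleDl.

Lemma dialg_pi_scaleE c a : c *: (dialg_pi a : Q) = dialg_pi (c *: a).
Proof. exact: dialg_pi_scale. Qed.

Lemma quot_vdash_linearl y : linear (quot_vdash^~ y).
Proof.
move=> c x z; rewrite -[x]dialg_reprK -[y]dialg_reprK -[z]dialg_reprK dialg_pi_scaleE -dialg_pi_add.
by rewrite !dialg_pi_vdash vdash_linearl dialg_pi_add -dialg_pi_scaleE.
Qed.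
Lemma quot_vdash_linearr y : linear (quot_vdash y).
Proof.
move=> c x z; rewrite -[x]dialg_reprK -[y]dialg_reprK -[z]dialg_reprK dialg_pi_scaleE -dialg_pi_add.
by rewrite !dialg_pi_vdash vdash_linearr dialg_pi_add -dialg_pi_scaleE.
Qed.
Lemma quot_dashv_linearl y : linear (quot_dashv^~ y).
Proof.
move=> c x z; rewrite -[x]dialg_reprK -[y]dialg_reprK -[z]dialg_reprK dialg_pi_scaleE -dialg_pi_add.
by rewrite !dialg_pi_dashv dashv_linearl dialg_pi_add -dialg_pi_scaleE.
Qed.
Lemma quot_dashv_linearr y : linear (quot_dashv y).
Proof.
move=> c x z; rewrite -[x]dialg_reprK -[y]dialg_reprK -[z]dialg_reprK dialg_pi_scaleE -dialg_pi_add.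
by rewrite !dialg_pi_dashv dashv_linearr dialg_pi_add -dialg_pi_scaleE.
Qed.
Lemma quot_vdashA : associative quot_vdash.
Proof.
move=> x y z; rewrite -[x]dialg_reprK -[y]dialg_reprK -[z]dialg_reprK.
by rewrite !(dialg_pi_vdash, dialg_pi_dashv) vdashA.
Qed.
Lemma quot_dashvA : associative quot_dashv.
Proof.
move=> x y z; rewrite -[x]dialg_reprK -[y]dialg_reprK -[z]dialg_reprK.
by rewrite !(dialg_pi_vdash, dialg_pi_dashv) dashvA.
Qed.
Lemma quot_vdashC : commutative quot_vdash.
Proof. by move=> x y; rewrite /quot_vdash vdashC. Qed.
Lemma quot_dashvC : commutative quot_dashv.
Proof. by move=> x y; rewrite /quot_dashv dashvC. Qed.
Lemma quot_dashv_vdash x y z :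
  quot_dashv x (quot_vdash y z) = quot_dashv x (quot_dashv y z).
Proof.
rewrite -[x]dialg_reprK -[y]dialg_reprK -[z]dialg_reprK.
by rewrite !(dialg_pi_vdash, dialg_pi_dashv) dashv_vdash.
Qed.
Lemma quot_vdash_dashv x y z :
  quot_vdash (quot_dashv x y) z = quot_vdash (quot_vdash x y) z.
Proof.
rewrite -[x]dialg_reprK -[y]dialg_reprK -[z]dialg_reprK.
by rewrite !(dialg_pi_vdash, dialg_pi_dashv) vdash_dashv.
Qed.
Lemma quot_vdash_dashvA x y z :
  quot_vdash x (quot_dashv y z) = quot_dashv (quot_vdash x y) z.
Proof.
rewrite -[x]dialg_reprK -[y]dialg_reprK -[z]dialg_reprK.
by rewrite !(dialg_pi_vdash, dialg_pi_dashv) vdash_dashvA.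
Qed.

HB.instance Definition _ := Lmodule_isComDialgebra.Build k Q
  quot_vdash_linearl quot_vdash_linearr quot_dashv_linearl quot_dashv_linearr
  quot_vdashA quot_dashvA quot_vdashC quot_dashvC
  quot_dashv_vdash quot_vdash_dashv quot_vdash_dashvA.

End QuotientDialgebra.

(* The family (e i), i in P, is a basis of V (in particular, the e i are
   pairwise distinct). *)
Definition is_basis_family (k : fieldType) (V : lmodType k) (I : choiceType)
    (P : set I) (e : I -> V) : Prop :=
  (forall v : V, exists (s : seq I) (c : I -> k),
     (forall i, i \in s -> P i) /\ v = \sum_(i <- s) c i *: e i) /\
  (forall (s : seq I) (c : I -> k),
     uniq s -> (forall i, i \in s -> P i) ->
     \sum_(i <- s) c i *: e i = 0 -> forall i, i \in s -> c i = 0).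

(* Elements of the free commutative monoid on X are the w : {cmonom X}, with
   unit 1%M, product ( * )%M, generators ucm x and length mdeg w. The free
   commutative semigroup without unit is made of the w <> 1. *)
Record cword (X : choiceType) :=
  CWord { cword_val : {cmonom X}; _ : cword_val != 1%M }.
HB.instance Definition _ (X : choiceType) := [isSub for @cword_val X].
HB.instance Definition _ (X : choiceType) := [Choice of cword X by <:].

Section Words.
Context {X : choiceType}.
Implicit Types (u v w : cword X) (x : X).

Lemma cwmul_subproof u v : (cword_val u * cword_val v)%M != 1%M.
Proof. by apply: contra (valP u) => /unitmP[]. Qed.
Definition cwmul u v : cword X := CWord (cwmul_subproof u v).

Lemma cwU_subproof x : ucm x != 1%M.
Proof. by rewrite -mdeg_eq0 mdegU. Qed.
Definition cwU x : cword X := CWord (cwU_subproof x).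

Definition cmdvd (u w : {cmonom X}) : Prop := exists a, w = (u * a)%M.

Definition is_lcm (u v w : {cmonom X}) : Prop :=
  [/\ cmdvd u w, cmdvd v w & forall z, cmdvd u z -> cmdvd v z -> cmdvd w z].

Definition wlt (le : rel (cword X)) : rel (cword X) :=
  fun u v => le u v && (u != v).

(* well_order le entails that le is a total order. *)
Definition monomial_order (le : rel (cword X)) : Prop :=
  well_order le /\
  (forall u v w, wlt le v u -> wlt le (cwmul v w) (cwmul u w)).

End Words.

(* The pair (u, m) stands for the basis element u with subscript m, where
   m = 1, or m = 2 and |u| = 2. *)
Record dimon (X : choiceType) := DiMon {
  dimon_val : cword X * nat;
  _ : (dimon_val.2 == 1%N) ||
      (dimon_val.2 == 2%N) && (mdeg (cword_val dimon_val.1) == 2%N)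
}.
HB.instance Definition _ (X : choiceType) := [isSub for @dimon_val X].
HB.instance Definition _ (X : choiceType) := [Choice of dimon X by <:].

Section BasisElements.
Context {X : choiceType}.
Implicit Types (u v w : cword X) (a b : dimon X) (x : X).

Definition dword a : cword X := (dimon_val a).1.
Definition dindex a : nat := (dimon_val a).2.

Definition mon1 u : dimon X := @DiMon X (u, 1%N) isT.

Lemma mon2_subproof u :
  let m := if mdeg (cword_val u) == 2%N then 2%N else 1%N in
  (m == 1%N) || (m == 2%N) && (mdeg (cword_val u) == 2%N).
Proof. by case: (mdeg (cword_val u) == 2%N). Qed.

(* u with subscript 2 if |u| = 2, and u with subscript 1 otherwise. *)
Definition mon2 u : dimon X := @DiMon X (u, _) (mon2_subproof u).

Definition letter x : dimon X := mon1 (cwU x).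

(* Since |uv| = 2 only if u and v are letters, these are the products of the
   basis elements. *)
Definition mon_vdash a b : dimon X := mon2 (cwmul (dword a) (dword b)).
Definition mon_dashv a b : dimon X := mon1 (cwmul (dword a) (dword b)).

End BasisElements.

Definition Di (k : fieldType) (X : choiceType) := {malg k[dimon X]}.

Section FreeDialgebra.
Context {k : fieldType} {X : choiceType}.
Local Notation D := (Di k X).
Implicit Types (f g h : D) (a b : dimon X) (u v w : cword X).
Implicit Types (op : dimon X -> dimon X -> dimon X).

HB.instance Definition _ := GRing.Lmodule.on D.

Definition dmon a : D := << a >>.
Definition gen x : D := dmon (letter x).

(* The bilinear extension of op. *)
Definition bilin op f g : D :=
  \sum_(a <- msupp f) \sum_(b <- msupp g) (f@_a * g@_b) *: dmon (op a b).

Definition linext (F : dimon X -> D) f : D :=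
  \sum_(a <- msupp f) f@_a *: F a.

Lemma linextEw F (E : {fset dimon X}) f : fsubset (msupp f) E ->
  linext F f = \sum_(a <- E) f@_a *: F a.
Proof.
move=> sfE; rewrite /linext; apply: big_fset_incl => // a _ /mcoeff_outdom ->.
by rewrite scale0r.
Qed.

Lemma linext_linear F : linear (linext F).
Proof.
move=> c f g; pose E := fsetU (msupp f) (msupp g).
have sf : fsubset (msupp f) E by apply: fsubsetUl.
have sg : fsubset (msupp g) E by apply: fsubsetUr.
have scg : fsubset (msupp (c *: f + g)) E.
  apply: fsubset_trans (msuppD_le _ _) _.
  by rewrite fsubUset sg andbT; apply: fsubset_trans (msuppZ_le _ _) sf.
rewrite (linextEw _ sf) (linextEw _ sg) (linextEw _ scg) scaler_sumr -big_split.
apply: eq_bigr => a _ /=.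
by rewrite mcoeffD mcoeffZ scalerDl scalerA.
Qed.

Lemma linext_dmon F a : linext F (dmon a) = F a.
Proof.
rewrite (linextEw _ (E := fset1 a)) ?msuppU_le //.
by rewrite big_seq_fset1 mcoeffUU scale1r.
Qed.

Lemma dmon_sum f : f = \sum_(a <- msupp f) f@_a *: dmon a.
Proof.
rewrite {1}[f]monalgE; apply: eq_bigr => a _; apply/malgP => b.
rewrite [in RHS](mcoeffZ (f@_a) (dmon a) b) [in RHS](mcoeffU a 1 b).
by rewrite (mcoeffU a _ b) mulr_natr.
Qed.

Lemma linear_sum_dmon (F : D -> D) f : linear F ->
  F f = \sum_(a <- msupp f) f@_a *: F (dmon a).
Proof.
move=> linF.
have F0 : F 0 = 0.
  by have := linF (-1) 0 0; rewrite scaler0 addr0 scaleN1r addNr.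
rewrite {1}[f]dmon_sum; elim: (enum_fset (msupp f)) => [|a s IHs].
  by rewrite [in LHS]big_nil F0 [in RHS]big_nil.
by rewrite [in LHS]big_cons linF IHs [in RHS]big_cons.
Qed.

Lemma eq_linear_dmon (F G : D -> D) : linear F -> linear G ->
  (forall a, F (dmon a) = G (dmon a)) -> F =1 G.
Proof.
move=> linF linG eqFG f; rewrite (linear_sum_dmon f linF).
by rewrite (linear_sum_dmon f linG); apply: eq_bigr => a _; rewrite eqFG.
Qed.

Lemma bilinE op f g : bilin op f g = linext (fun a => linext (dmon \o op a) g) f.
Proof.
apply: eq_bigr => a _; rewrite scaler_sumr; apply: eq_bigr => b _.
by rewrite scalerA.
Qed.

Lemma bilin_linearl op g : linear (bilin op ^~ g).
Proof. by move=> c f h; rewrite !bilinE linext_linear. Qed.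

Lemma bilin_linearr op f : linear (bilin op f).
Proof.
move=> c g h; rewrite !bilinE [in RHS]/linext scaler_sumr -big_split.
apply: eq_bigr => a _.
rewrite (linext_linear _ c g h) scalerDr /= !scalerA.
by rewrite [c * _]mulrC.
Qed.

Lemma bilin_dmon op a b : bilin op (dmon a) (dmon b) = dmon (op a b).
Proof. by rewrite bilinE !linext_dmon. Qed.

Lemma bilinC op : commutative op -> commutative (bilin op).
Proof.
move=> opC f g; rewrite /bilin exchange_big; apply: eq_bigr => b _.
by apply: eq_bigr => a _; rewrite opC mulrC.
Qed.

(* Identities of this shape need only be checked on basis elements. *)
Lemma bilin3 op1 op2 op3 op4 :
  (forall a b c, op1 a (op2 b c) = op3 (op4 a b) c) ->
  forall f g h, bilin op1 f (bilin op2 g h) = bilin op3 (bilin op4 f g) h.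
Proof.
move=> eqop f g h; move: f.
apply: eq_linear_dmon => [||a].
- exact: bilin_linearl.
- by move=> c f f'; rewrite !bilin_linearl.
move: g; apply: eq_linear_dmon => [||b].
- by move=> c f f'; rewrite bilin_linearl bilin_linearr.
- by move=> c f f'; rewrite bilin_linearr bilin_linearl.
move: h; apply: eq_linear_dmon => [||c].
- by move=> c f f'; rewrite !bilin_linearr.
- exact: bilin_linearr.
by rewrite !bilin_dmon eqop.
Qed.

Lemma cwmulC : commutative (@cwmul X).
Proof. by move=> u v; apply: val_inj; apply: mulmC. Qed.

Lemma cwmulA : associative (@cwmul X).
Proof. by move=> u v w; apply: val_inj; apply: mulmA. Qed.

Lemma mon2_gt2 u : (2 < mdeg (cword_val u))%N -> mon2 u = mon1 u.
Proof.
move=> gt2; apply: val_inj => /=.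
by rewrite (gtn_eqF gt2).
Qed.

Lemma mdeg_cword_gt0 (u : cword X) : (0 < mdeg (cword_val u))%N.
Proof. by rewrite lt0n mdeg_eq0 (valP u). Qed.

Lemma mon2_mul3 u v w : mon2 (cwmul u (cwmul v w)) = mon1 (cwmul u (cwmul v w)).
Proof.
apply: mon2_gt2; rewrite /= !mdegM.
move: (mdeg_cword_gt0 u) (mdeg_cword_gt0 v) (mdeg_cword_gt0 w).
by move=> u0 v0 w0; apply: (leq_add u0 (leq_add v0 w0)).
Qed.

Definition di_vdash : D -> D -> D := bilin mon_vdash.
Definition di_dashv : D -> D -> D := bilin mon_dashv.

Lemma di_vdashA : associative di_vdash.
Proof.
by apply: (@bilin3 mon_vdash mon_vdash mon_vdash mon_vdash) => a b c;
  rewrite /mon_vdash /= cwmulA.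
Qed.
Lemma di_dashvA : associative di_dashv.
Proof.
by apply: (@bilin3 mon_dashv mon_dashv mon_dashv mon_dashv) => a b c;
  rewrite /mon_dashv /= cwmulA.
Qed.
Lemma di_vdashC : commutative di_vdash.
Proof. by apply: bilinC => a b; rewrite /mon_vdash cwmulC. Qed.
Lemma di_dashvC : commutative di_dashv.
Proof. by apply: bilinC => a b; rewrite /mon_dashv cwmulC. Qed.
Lemma di_dashv_vdash f g h :
  di_dashv f (di_vdash g h) = di_dashv f (di_dashv g h).
Proof.
transitivity (di_dashv (di_dashv f g) h); last exact/esym/di_dashvA.
apply: (@bilin3 mon_dashv mon_vdash mon_dashv mon_dashv) => a b c.
by rewrite /mon_dashv /mon_vdash /= cwmulA.
Qed.
Lemma di_vdash_dashv f g h :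
  di_vdash (di_dashv f g) h = di_vdash (di_vdash f g) h.
Proof.
transitivity (di_vdash f (di_vdash g h)); last exact: di_vdashA.
apply/esym; apply: (@bilin3 mon_vdash mon_vdash mon_vdash mon_dashv) => a b c.
by rewrite /mon_dashv /mon_vdash /= cwmulA.
Qed.
Lemma di_vdash_dashvA f g h :
  di_vdash f (di_dashv g h) = di_dashv (di_vdash f g) h.
Proof.
apply: (@bilin3 mon_vdash mon_dashv mon_dashv mon_vdash) => a b c.
by rewrite /mon_dashv /mon_vdash /= mon2_mul3 cwmulA.
Qed.

HB.instance Definition _ := Lmodule_isComDialgebra.Build k D
  (bilin_linearl mon_vdash) (bilin_linearr mon_vdash)
  (bilin_linearl mon_dashv) (bilin_linearr mon_dashv)
  di_vdashA di_dashvA di_vdashC di_dashvC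
  di_dashv_vdash di_vdash_dashv di_vdash_dashvA.

End FreeDialgebra.

(* Strict order on option T induced by a strict relation, with None as least
   element: None plays the role of the leading monomial (word) of 0. *)
Definition olt (T : Type) (lt : rel T) (x y : option T) : bool :=
  match x, y with
  | _, None => false
  | None, Some _ => true
  | Some a, Some b => lt a b
  end.

Section GroebnerShirshov.
Context {k : fieldType} {X : choiceType} (le : rel (cword X)).
Local Notation D := (Di k X).
Implicit Types (f g h s p q : D) (u v w : cword X) (x : X) (S : set D).

(* Strict monomial-center order: lexicographic on (word, subscript). *)
Definition mclt : rel (dimon X) := fun a b =>
  wlt le (dword a) (dword b) ||
  (dword a == dword b) && (dindex a < dindex b)%N.

Definition lm f : option (dimon X) :=
  ohead [seq a <- msupp f | all (fun b => (b == a) || mclt b a) (msupp f)].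

Definition lw f : option (cword X) := omap dword (lm f).

Definition lc f : k := if lm f is Some a then f@_a else 0.

Definition lead_term f : D := if lm f is Some a then f@_a *: dmon a else 0.

Definition rest f : D := f - lead_term f.

Definition lsize f : nat := if lw f is Some u then mdeg (cword_val u) else 0%N.

Definition lindex f : nat := if lm f is Some a then dindex a else 0%N.

Definition lm_le f g : Prop := lm f = lm g \/ olt mclt (lm f) (lm g).

Definition monic f : Prop := lc f = 1.

Definition monic_set S : Prop := forall s, S s -> monic s.

Definition strong f : Prop := f <> 0 /\ olt (wlt le) (lw (rest f)) (lw f).

(* normal_poly s b m h: the normal s-polynomial with word b and subscript m is
   defined and equal to h. *)
Variant normal_poly s : {cmonom X} -> nat -> D -> Prop :=
| NormalNil : normal_poly s 1%M (lindex s) s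
| NormalVdash x :
    lsize s = 1%N -> normal_poly s (ucm x) 2%N (s ⊢ gen x)
| NormalDashv (b : cword X) :
    strong s -> normal_poly s (cword_val b) 1%N (s ⊣ dmon (mon1 b)).

Definition normal_S_poly S h : Prop :=
  exists (s : D) (b : {cmonom X}) (m : nat), S s /\ normal_poly s b m h.

Variant composition S : D -> Prop :=
| MulCompVdash f x :
    S f -> ~ strong f -> composition S (f ⊢ gen x)
| MulCompDashv f x :
    S f -> ~ strong f -> composition S (f ⊣ gen x)
| SpecialComp f x :
    S f -> strong f -> (1 < lsize f)%N ->
    (exists y : X, letter y \in msupp f) ->
    composition S (f ⊢ gen x - f ⊣ gen x)
| EqualComp f g :
    S f -> S g -> f <> g -> lm f = lm g -> composition S (f - g)
| ShortInterComp f g x m p :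
    S f -> S g -> lsize f = 2%N -> lsize g = 1%N ->
    normal_poly g (ucm x) m p -> lm f = lm p ->
    composition S (f - p)
| EqualMulComp f g x p q :
    S f -> S g -> strong f -> strong g -> (3 < lsize f + lsize g)%N ->
    lm f <> lm g -> lw f = lw g ->
    normal_poly f (ucm x) 1%N p -> normal_poly g (ucm x) 1%N q ->
    composition S (p - q)
| LongInterComp f g u v (a b w : {cmonom X}) p q :
    S f -> S g -> strong f -> strong g -> (3 < lsize f + lsize g)%N ->
    lm f <> lm g -> lw f = Some u -> lw g = Some v -> u <> v ->
    is_lcm (cword_val u) (cword_val v) w ->
    w = (cword_val u * a)%M -> w = (cword_val v * b)%M -> b <> 1%M ->
    (mdeg w < lsize f + lsize g)%N ->
    normal_poly f a 1%N p -> normal_poly g b 1%N q ->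
    composition S (p - q).

Definition trivial_mod S h : Prop :=
  exists (n : nat) (c : 'I_n -> k) (p : 'I_n -> D),
    [/\ h = \sum_(i < n) c i *: p i,
        forall i, normal_S_poly S (p i) &
        forall i, c i != 0 -> lm_le (p i) h].

Definition GS_basis S : Prop :=
  monic_set S /\ forall h, composition S h -> trivial_mod S h.

Definition Irr S : set (dimon X) :=
  [set a | forall h, normal_S_poly S h -> Some a <> lm h].

End GroebnerShirshov.

(* Main.v *)
Require Import Defs.
From mathcomp Require Import all_boot all_order all_algebra finmap monalg.
From mathcomp Require Import boolp classical_sets wochoice.
From mathcomp Require Import zify.

Set Implicit Arguments.
Unset Strict Implicit.
Unset Printing Implicit Defensive.

Import GRing.Theory.
Local Open Scope ring_scope.

(** The two equivalences have the shape of the classical ones for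
    Groebner bases, and only one implication is more than linear algebra:
    that (i) implies (ii).

    For a predicate P on basis elements let [nspan S P] be the span of the
    normal S-polynomials whose leading monomial satisfies P. When all
    compositions are trivial, two things hold.

    - Every element of Id(S) lies in the span of the normal S-polynomials
      ([Id_nspan]). The point is that a normal polynomial times a letter is
      again a combination of normal ones with leading words no larger than
      the expected word ([nspan_diprod_letter]); multiplication compositions
      give this for s in S that is not strong; for s strong s ⊣ x is normal,
      and special compositions give it for s ⊢ x. Longer words are products of
      letters. As the bound on leading words is kept, a combination with
      leading words below w becomes, after multiplication by b, one with
      leading words below wb ([nspan_below_diprod]).

    - Two normal polynomials with the same leading monomial a differ by a
      combination of normal polynomials with leading monomials below a
      ([nspan_same_lead]). If a has subscript 1, both are products of strong
      polynomials f, g of S by words, and their difference is a multiple of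
      the difference taken at the least common multiple of the two leading
      words ([nspan_overlap]). There, up to some care with the subscripts in
      length two, it is zero or a composition, except when the leading words
      are coprime; then commutativity settles it, since
      f g = g f rewrites f times the leading word of g, minus g times the
      leading word of f, in terms of the tails of f and g ([nspan_swap]).
      If a has subscript 2, its word has length two and only few cases remain.

    Given a nonzero f in Id(S), write it as a combination of normal
    polynomials with largest leading monomial a. If a is not the leading
    monomial of f, the terms with leading monomial a cancel, and the second
    fact replaces them by terms with smaller leading monomials; the ordering
    is well founded, so the process stops ([GS_lm_normal]).

    Conversely, under (ii) the elements of Id(S), among them all compositions,
    are reduced to 0 by cancelling leading terms with normal polynomials
    ([Id_nspan_lm]). The same reduction, which leaves irreducible leading
    terms in place, shows that Irr(S) always spans the quotient ([reduction]),
    and that (ii) says exactly that no nonzero combination of irreducible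
    elements lies in Id(S) ([lm_normal_basis]). *)

Local Notation "1" := (@mone _) : monom_scope.
Local Notation "u * v" := (mmul u v) : monom_scope.

(** * Words and their least common multiples *)

Section CommutativeWords.
Context {X : choiceType}.
Implicit Types (m a b : {cmonom X}) (u v w : cword X) (x : X).

Lemma cm_mulI a : injective (mmul a).
Proof.
move=> b c eq_bc; apply/eqP/cmP => i.
by have /eqP/cmP/(_ i) := eq_bc; rewrite !cmM => /addnI.
Qed.

Lemma cword_val_inj : injective (@cword_val X).
Proof. exact: val_inj. Qed.

Lemma cwmulI u : injective (cwmul u).
Proof. by move=> v w /(congr1 (@cword_val X)) /cm_mulI/cword_val_inj. Qed.

Lemma cm_factor m : m != 1%M -> exists x a, m = (ucm x * a)%M.
Proof.
move=> m_neq1; have [x mx] : exists x, m x != 0%N.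
  apply: contraPP m_neq1 => m0; apply/negP; rewrite negbK.
  apply/cmP => x; rewrite cm1; apply/eqP/negP => mx.
  by apply: m0; exists x; apply/negP.
exists x, (divcm m (ucm x)); apply/eqP/cmP => y.
rewrite cmM divcmE cmU; case: eqP => [<-|_]; last by rewrite subn0.
by rewrite subnKC // lt0n.
Qed.

Lemma cword_ind_letter (P : cword X -> Prop) :
  (forall x, P (cwU x)) -> (forall x u, P u -> P (cwmul (cwU x) u)) ->
  forall u, P u.
Proof.
move=> PU PM u; have [n] := ubnP (mdeg (cword_val u)).
elim: n u => // n IHn u; rewrite ltnS => le_un.
have [x [a ua]] := cm_factor (valP u).
have [a1|a_neq1] := eqVneq a 1%M.
  by rewrite (_ : u = cwU x) //; apply: val_inj; rewrite ua a1 /= mulm1.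
rewrite (_ : u = cwmul (cwU x) (CWord a_neq1)); last exact: cword_val_inj.
by apply/PM/IHn; move: le_un; rewrite ua mdegM mdegU.
Qed.

Lemma cword_mdeg1 u : mdeg (cword_val u) = 1%N -> exists x, u = cwU x.
Proof.
have [x [a ua]] := cm_factor (valP u).
rewrite ua mdegM mdegU => -[/mdeg_eq0I a1].
by exists x; apply: cword_val_inj; rewrite ua a1 /= mulm1.
Qed.

Lemma cword_mdeg_cases u :
  mdeg (cword_val u) = 1%N \/ (1 < mdeg (cword_val u))%N.
Proof.
by have := mdeg_cword_gt0 u; rewrite leq_eqVlt => /orP[/eqP|]; [left|right].
Qed.

(** The exponents of the least common multiple are the pointwise maxima;
    the truncated quotients [divcm v u] and [divcm u v] are its cofactors, and
    both sides of the given equality are multiples of it by the same word. *)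
Lemma cm_lcm (u v a b : {cmonom X}) : (u * a = v * b)%M ->
  exists w a' b' c : {cmonom X},
    [/\ is_lcm u v w, w = (u * a')%M, w = (v * b')%M,
        a = (a' * c)%M & b = (b' * c)%M].
Proof.
move=> eq_ab; have eqE x : (u x + a x = v x + b x)%N.
  by have /eqP/cmP/(_ x) := eq_ab; rewrite !cmM.
have wE : (u * divcm v u = v * divcm u v)%M.
  by apply/eqP/cmP => x; rewrite !cmM !divcmE -!maxnE maxnC.
exists (u * divcm v u)%M, (divcm v u), (divcm u v), (divcm a (divcm v u)).
split=> //; first split.
- by exists (divcm v u).
- by exists (divcm u v).
- move=> _ [c ->] [c' eq_c]; exists (divcm c (divcm v u)).
  apply/eqP/cmP => x; have /eqP/cmP/(_ x) := eq_c.
  rewrite !cmM !divcmE; move: (u x) (v x) (c x) (c' x) => i j l l' /=; lia.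
- apply/eqP/cmP => x; move: (eqE x); rewrite !cmM !divcmE;
    move: (u x) (v x) (a x) (b x) => i j l l' /=; lia.
- apply/eqP/cmP => x; move: (eqE x); rewrite !cmM !divcmE;
    move: (u x) (v x) (a x) (b x) => i j l l' /=; lia.
Qed.

End CommutativeWords.

(** * The monomial-center ordering *)

Section Orders.
Context {X : choiceType} (le : rel (cword X)) (hle : monomial_order le).
Implicit Types (u v w : cword X) (a b c : dimon X).
Local Notation lt := (wlt le).
Local Notation mclt := (mclt le).

Lemma le_chain : wo_chain le predT.
Proof. by move=> A _; apply: hle.1. Qed.

Lemma le_total u v : le u v || le v u.
Proof. exact: (wo_chainW le_chain). Qed.

Lemma le_refl u : le u u.
Proof. by have := le_total u u; rewrite orbb. Qed.

Lemma le_anti u v : le u v -> le v u -> u = v.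
Proof.
by move=> uv vu; apply: (wo_chain_antisymmetric le_chain) => //; apply/andP.
Qed.

Lemma le_trans : transitive le.
Proof.
move=> v u w uv vw.
have [|z [[/= zA lbz] _]] := hle.1 [pred t | [|| t == u, t == v | t == w]].
  by exists u; rewrite inE eqxx.
have lbu : le z u by apply: lbz; rewrite inE eqxx.
have lbv : le z v by apply: lbz; rewrite inE eqxx orbT.
have lbw : le z w by apply: lbz; rewrite inE eqxx !orbT.
case/or3P: zA lbu lbv lbw => /eqP-> zu zv zw //.
  by rewrite (le_anti uv).
by rewrite -(le_anti vw).
Qed.

Lemma ltW u v : lt u v -> le u v.
Proof. by case/andP. Qed.

Lemma ltxx u : lt u u = false.
Proof. by rewrite /wlt eqxx andbF. Qed.

Lemma le_eqVlt u v : le u v = (u == v) || lt u v.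
Proof.
by rewrite /wlt; case: eqVneq => [->|] /=; rewrite ?le_refl ?andbT.
Qed.

Lemma le_lt_trans u v w : le u v -> lt v w -> lt u w.
Proof.
move=> uv /andP[vw neq]; rewrite /wlt (le_trans uv vw) /=.
by apply: contra neq => /eqP uw; rewrite (le_anti vw) // -uw.
Qed.

Lemma lt_le_trans u v w : lt u v -> le v w -> lt u w.
Proof.
move=> /andP[uv neq] vw; rewrite /wlt (le_trans uv vw) /=.
by apply: contra neq => /eqP uw; rewrite (le_anti uv) // uw.
Qed.

Lemma ltNge u v : lt u v = ~~ le v u.
Proof.
rewrite /wlt; have := le_total u v; case: (eqVneq u v) => [->|neq] /=.
  by rewrite le_refl andbF.
rewrite andbT; case: (boolP (le v u)) => [vu _|_ /orP[]//].
by apply: contraNF neq => uv; rewrite (le_anti uv).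
Qed.

Lemma lt_mul u v w : lt u v -> lt (cwmul u w) (cwmul v w).
Proof. exact: hle.2. Qed.

Lemma le_mul u v w : le u v -> le (cwmul u w) (cwmul v w).
Proof.
rewrite !le_eqVlt => /orP[/eqP->|/lt_mul ->]; first by rewrite eqxx.
by rewrite orbT.
Qed.

Lemma wlt_wf : well_founded lt.
Proof.
move=> u; apply: contrapT => nAu.
have [|m [[/asboolP nAm lbm] _]] := hle.1 [pred v | `[< ~ Acc lt v >]].
  by exists u; apply/asboolP.
apply: nAm; constructor => v; rewrite ltNge => /negP Nmv.
by apply: contrapT => nAv; apply/Nmv/lbm/asboolP.
Qed.

Lemma dimonP a b : dword a = dword b -> dindex a = dindex b -> a = b.
Proof.
move=> eqw eqi; apply: val_inj.
by case: a b eqw eqi => [[u i] ?] [[v j] ?]; rewrite /dword /dindex /= => -> ->.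
Qed.

Lemma mclt_wlt a b : lt (dword a) (dword b) -> mclt a b.
Proof. by rewrite /mclt => ->. Qed.

Lemma mclt_le a b : mclt a b -> le (dword a) (dword b).
Proof. by case/orP => [/ltW//|/andP[/eqP-> _]]; apply: le_refl. Qed.

Lemma mcltxx a : mclt a a = false.
Proof. by rewrite /mclt ltxx ltnn andbF. Qed.

Lemma mclt_trans : transitive mclt.
Proof.
move=> b a c /orP[ab|/andP[/eqP ab iab]].
  by move/mclt_le => bc; apply/mclt_wlt/(lt_le_trans ab).
rewrite /mclt ab => /orP[-> //|/andP[/eqP-> ibc]].
by rewrite eqxx (ltn_trans iab) ?orbT.
Qed.

Lemma mclt_total a b : [\/ a = b, mclt a b | mclt b a].
Proof.
rewrite /mclt; case: (boolP (lt (dword a) (dword b))) => [_|].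
  by constructor 2.
rewrite ltNge negbK le_eqVlt => /orP[/eqP eqw|->]; last by constructor 3.
rewrite eqw eqxx ltxx /=.
have [lt_ab|gt_ab|eq_ab] := ltngtP (dindex a) (dindex b).
- by constructor 2.
- by constructor 3.
- by constructor 1; apply: dimonP.
Qed.

Lemma mclt_wf : well_founded mclt.
Proof.
(* The order is lexicographic: induct on the word, then on the subscript. *)
suff accP u n a : dword a = u -> dindex a = n -> Acc mclt a.
  by move=> a; apply: accP.
elim/(well_founded_ind wlt_wf): u n a => u IHu n.
elim/ltn_ind: n => n IHn a au an; constructor => b.
rewrite /Defs.mclt au an => /orP[lt_bu|/andP[/eqP bu lt_bn]].
  exact: IHu lt_bu _ _ erefl erefl.
exact: IHn lt_bn _ bu erefl.
Qed.

End Orders.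

(** * Supports and products in the free dialgebra *)

Section Supports.
Context {k : fieldType} {X : choiceType}.
Local Notation D := (Di k X).
Implicit Types (f g h : D) (a b : dimon X) (P Q R : dimon X -> Prop).

Definition supp_in P f : Prop := forall a, f@_a != 0 -> P a.

Lemma coeff_dmon a b : (dmon a : D)@_b = (a == b)%:R.
Proof. exact: mcoeffU. Qed.

Lemma coeffZ (c : k) f a : (c *: f)@_a = c * f@_a.
Proof. exact: (@mcoeffZ (dimon X) k). Qed.

Lemma supp_in0 P : supp_in P 0.
Proof. by move=> a; rewrite mcoeff0 eqxx. Qed.

Lemma supp_inD P f g : supp_in P f -> supp_in P g -> supp_in P (f + g).
Proof.
move=> Pf Pg a; rewrite mcoeffD => nz; have [fa0|/Pf//] := eqVneq f@_a 0.
by apply: Pg; rewrite fa0 add0r in nz.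
Qed.

Lemma supp_inZ P (c : k) f : supp_in P f -> supp_in P (c *: f).
Proof. by move=> Pf a; rewrite coeffZ mulf_eq0 => /norP[_ /Pf]. Qed.

Lemma supp_inB P f g : supp_in P f -> supp_in P g -> supp_in P (f - g).
Proof.
move=> Pf Pg; apply: supp_inD => // a.
by rewrite mcoeffN oppr_eq0; apply: Pg.
Qed.

Lemma supp_in_dmon P a : P a -> supp_in P (dmon a).
Proof.
move=> Pa b; rewrite coeff_dmon.
by case: (eqVneq a b) => [<-//|_]; rewrite eqxx.
Qed.

Lemma supp_in_sum P I (s : seq I) (c : I -> k) (F : I -> D) :
  (forall i, c i != 0 -> supp_in P (F i)) ->
  supp_in P (\sum_(i <- s) c i *: F i).
Proof.
move=> PF; elim: s => [|i s IHs]; first by rewrite big_nil; apply: supp_in0.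
rewrite big_cons; apply: supp_inD IHs; have [->|/PF] := eqVneq (c i) 0.
  by rewrite scale0r; apply: supp_in0.
exact: supp_inZ.
Qed.

Lemma supp_inW P Q f : (forall a, P a -> Q a) -> supp_in P f -> supp_in Q f.
Proof. by move=> PQ Pf a /Pf/PQ. Qed.

Lemma supp_in_bilin op P Q R f g :
  (forall a b, P a -> Q b -> R (op a b)) ->
  supp_in P f -> supp_in Q g -> supp_in R (bilin op f g).
Proof.
move=> PQR Pf Qg; rewrite bilinE /linext.
apply: (supp_in_sum (c := fun a => f@_a)) => a /Pf Pa.
apply: (supp_in_sum (c := fun b => g@_b)) => b /Qg Qb.
exact: (supp_in_dmon (PQR _ _ Pa Qb)).
Qed.

Lemma bilinBl op f g h : bilin op (f - g) h = bilin op f h - bilin op g h.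
Proof.
by rewrite addrC -(scaleN1r g) bilin_linearl (scaleN1r (_ : D)) addrC.
Qed.

Lemma bilinBr op f g h : bilin op h (f - g) = bilin op h f - bilin op h g.
Proof.
by rewrite addrC -(scaleN1r g) bilin_linearr (scaleN1r (_ : D)) addrC.
Qed.

Lemma bilin0l op f : bilin op 0 f = 0.
Proof. by rewrite -[X in bilin op X](subrr 0) bilinBl subrr. Qed.

(** The two products enter most arguments in the same way; a boolean selects
    ⊢ when true and ⊣ when false. *)
Definition mon_prod (c : bool) : dimon X -> dimon X -> dimon X :=
  if c then mon_vdash else mon_dashv.

Definition diprod (c : bool) (f g : D) : D := bilin (mon_prod c) f g.

Lemma diprodF f g : diprod false f g = f ⊣ g. Proof. by []. Qed.

Lemma diprodC c : commutative (diprod c).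
Proof. by case: c => f g; [apply: vdashC|apply: dashvC]. Qed.

Lemma dword_prod c a b : dword (mon_prod c a b) = cwmul (dword a) (dword b).
Proof. by case: c. Qed.

Lemma diprod_dmon c a b : diprod c (dmon a) (dmon b) = dmon (mon_prod c a b).
Proof. exact: bilin_dmon. Qed.

Lemma dindexP a :
  dindex a = 1%N \/ dindex a = 2%N /\ mdeg (cword_val (dword a)) = 2%N.
Proof.
case: a => -[u i] i12; case/orP: (i12) => [/eqP|/andP[/eqP ? /eqP ?]].
  by left.
by right.
Qed.

Lemma dimon_letter a :
  mdeg (cword_val (dword a)) = 1%N -> exists x, a = letter x.
Proof.
move=> a1; have [x ax] := cword_mdeg1 a1; exists x; apply: dimonP => //.
by have [//|[_]] := dindexP a; rewrite a1.
Qed.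

Lemma mon2E a : dindex a = 2%N -> a = mon2 (dword a).
Proof.
move=> a2; have [|[_ da]] := dindexP a; first by rewrite a2.
by apply: dimonP => //; rewrite /dindex /= da eqxx.
Qed.

(** In length at least three there is only the subscript 1, so neither the
    choice of the product nor the subscript of the factor is visible. *)
Lemma diprod_long c c' f a b : dword a = dword b ->
  (1 < mdeg (cword_val (dword a)))%N ->
  diprod c f (dmon a) = diprod c' f (dmon b).
Proof.
move=> eqab a_gt1; have PE c1 a1 e : dword a1 = dword a ->
    mon_prod c1 e a1 = mon1 (cwmul (dword e) (dword a)).
  move=> eqa; case: c1; rewrite /mon_prod /mon_vdash /mon_dashv eqa //.
  apply: mon2_gt2; rewrite /= mdegM.
  exact: leq_add (mdeg_cword_gt0 _) a_gt1.
move: f; apply: eq_linear_dmon => [||e]; try exact: bilin_linearl.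
by rewrite !diprod_dmon !PE.
Qed.

(** For strong s this covers, uniformly in the word m, the normal polynomials
    whose leading monomial has subscript 1: s itself when m is empty, and
    s ⊣ m otherwise. *)
Definition dashw f (m : {cmonom X}) : D :=
  if insub m is Some u then f ⊣ dmon (mon1 (u : cword X)) else f.

Lemma dashw1 f : dashw f 1%M = f.
Proof. by rewrite /dashw insubF // eqxx. Qed.

Lemma dashwE f (u : cword X) : dashw f (cword_val u) = f ⊣ dmon (mon1 u).
Proof. by rewrite /dashw valK. Qed.

Lemma dashwP (m : {cmonom X}) : m = 1%M \/ exists u : cword X, m = cword_val u.
Proof. by have [|m1] := eqVneq m 1%M; [left|right; exists (CWord m1)]. Qed.

Lemma dashwM f m m' : dashw f (m * m')%M = dashw (dashw f m) m'.
Proof.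
have [->|[u ->]] := dashwP m; first by rewrite mul1m dashw1.
have [->|[v ->]] := dashwP m'; first by rewrite mulm1 dashw1.
rewrite -[(_ * _)%M]/(cword_val (cwmul u v)) !dashwE -dashvA.
by rewrite -[dmon (mon1 u) ⊣ _]/(diprod false _ _) diprod_dmon.
Qed.

Lemma dashwB f g m : dashw (f - g) m = dashw f m - dashw g m.
Proof. by rewrite /dashw; case: insub => // u; apply: bilinBl. Qed.

End Supports.

(** * Leading monomials *)

#[local] Arguments wlt : simpl never.
#[local] Arguments mclt : simpl never.

Section LeadingTerms.
Context {k : fieldType} {X : choiceType}.
Context (le : rel (cword X)) (hle : monomial_order le).
Local Notation D := (Di k X).
Local Notation lt := (wlt le).
Local Notation mclt := (mclt le).
Local Notation lm := (@lm k X le).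
Implicit Types (f g h : D) (a b : dimon X) (u v w : cword X).

Lemma seq_max (s : seq (dimon X)) a : a \in s ->
  exists2 m, m \in s & all (fun b => (b == m) || mclt b m) s.
Proof.
elim: s a => // c s IHs a _; case: s IHs => [_|d s IHs].
  by exists c; rewrite ?mem_head //= eqxx.
have [m ms allm] := IHs d (mem_head d s).
have [cm|lt_cm|lt_mc] := mclt_total hle c m.
- exists m; first by rewrite in_cons ms orbT.
  by apply/allP => b; rewrite in_cons cm => /orP[->//|/(allP allm)].
- exists m; first by rewrite in_cons ms orbT.
  apply/allP => b; rewrite in_cons => /orP[/eqP->|/(allP allm)//].
  by rewrite lt_cm orbT.
- exists c; first by rewrite in_cons eqxx.
  apply/allP => b; rewrite in_cons => /orP[->//|/(allP allm)].
  by case/orP => [/eqP->|/(mclt_trans hle)->]; rewrite ?lt_mc ?orbT.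
Qed.

Lemma lm_max f : f <> 0 -> exists a,
  [/\ lm f = Some a, f@_a != 0 & forall b, f@_b != 0 -> b = a \/ mclt b a].
Proof.
move=> nz; have /fset0Pn[c /seq_max[m mf allm]] : msupp f != fset0.
  apply/eqP => f0; apply: nz; apply/malgP => b.
  by rewrite mcoeff0; apply: mcoeff_outdom; rewrite f0 in_fset0.
have : has (fun a => all (fun b => (b == a) || mclt b a) (msupp f)) (msupp f).
  by apply/hasP; exists m.
rewrite has_filter /Defs.lm; case Es: filter => [//|a s] _ /=.
have : a \in a :: s by apply: mem_head.
rewrite -Es mem_filter => /andP[/allP alla af]; exists a; split=> //.
  by rewrite mcoeff_neq0.
by move=> b; rewrite mcoeff_neq0 => /alla/orP[/eqP|]; [left|right].
Qed.

Lemma lm_eq f a : f@_a != 0 -> (forall b, f@_b != 0 -> b = a \/ mclt b a) ->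
  lm f = Some a.
Proof.
move=> fa maxa; have [|c [-> fc maxc]] := @lm_max f.
  by move=> f0; rewrite f0 mcoeff0 eqxx in fa.
have [->//|ca] := maxa c fc; have [->//|ac] := maxc a fa.
by have := mcltxx le a; rewrite (mclt_trans hle ac ca).
Qed.

Lemma lm0 : lm 0 = None.
Proof. by rewrite /Defs.lm msupp0. Qed.

(** This says at once that f is monic and that its leading monomial is a;
    bounding the support of the tail avoids computing [lm]. *)
Definition lead a f : Prop := supp_in (fun b => mclt b a) (f - dmon a).

Lemma lead_dmon a : lead a (dmon a).
Proof. by rewrite /lead subrr; apply: supp_in0. Qed.

(** Being strong, for a monic f with leading monomial a, is the same bound on
    the tail as in [lead], but on words instead of monomials; this is what
    multiplication preserves. *)
Definition slead a f : Prop :=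
  supp_in (fun b => lt (dword b) (dword a)) (f - dmon a).

Lemma slead_lead a f : slead a f -> lead a f.
Proof. by apply: supp_inW => b; apply: mclt_wlt. Qed.

Lemma lead_max a f : lead a f ->
  f@_a = 1 /\ (forall b, f@_b != 0 -> b = a \/ mclt b a).
Proof.
move=> lf; split=> [|b fb].
  have [//|nz] := eqVneq (f@_a) 1; have := lf a.
  by rewrite mcoeffB coeff_dmon eqxx subr_eq0 mcltxx => /(_ nz).
have [->|neq] := eqVneq b a; [by left|right].
by apply: lf; rewrite mcoeffB coeff_dmon (eq_sym a b) (negPf neq) subr0.
Qed.

Lemma lead_lm a f : lead a f -> lm f = Some a.
Proof. by move=> /lead_max[fa maxa]; apply: lm_eq; rewrite ?fa ?oner_eq0. Qed.

Lemma lead_neq0 a f : lead a f -> f <> 0.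
Proof. by move=> /lead_lm lf f0; rewrite f0 lm0 in lf. Qed.

Lemma lead_lead_term a f : lead a f -> rest le f = f - dmon a.
Proof.
move=> lf; rewrite /rest /lead_term (lead_lm lf).
by have [-> _] := lead_max lf; rewrite scale1r.
Qed.

Lemma monic_lead f : Defs.monic le f -> exists a, lead a f.
Proof.
rewrite /Defs.monic /lc => mf; have [|a [lf fa maxa]] := @lm_max f.
  by move=> f0; rewrite f0 lm0 in mf; have := oner_neq0 k; rewrite -mf eqxx.
exists a => b; rewrite lf in mf; rewrite mcoeffB coeff_dmon.
case: (eqVneq a b) => [<-|neq]; first by rewrite mf subrr eqxx.
by rewrite subr0 => /maxa[ba|//]; rewrite ba eqxx in neq.
Qed.

Lemma leadB a f g : lead a f -> lead a g -> supp_in (fun b => mclt b a) (f - g).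
Proof.
by move=> lf lg; have := supp_inB lf lg; rewrite opprB addrA subrK.
Qed.

Lemma sleadB a f g : slead a f -> slead a g ->
  supp_in (fun b => lt (dword b) (dword a)) (f - g).
Proof.
by move=> lf lg; have := supp_inB lf lg; rewrite opprB addrA subrK.
Qed.

Lemma strongP a f : lead a f -> strong le f <-> slead a f.
Proof.
move=> lf; rewrite /strong /lw (lead_lm lf) (lead_lead_term lf) /=.
split=> [[_ sf]|sf].
- have [f0|/eqP nz] := eqVneq (f - dmon a) 0.
    by rewrite /slead f0; apply: supp_in0.
  have [c [lc _ maxc]] := lm_max nz; rewrite lc /= in sf.
  move=> b /maxc[->//|/(mclt_le hle) bc]; exact: (le_lt_trans hle bc sf).
- split; first exact: lead_neq0 lf.
  have [->|/eqP nz] := eqVneq (f - dmon a) 0; first by rewrite lm0.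
  by have [c [-> fc _]] := lm_max nz; apply: sf.
Qed.

(** A subscript is at least 1, so no other basis element with the same word
    is smaller than one with subscript 1. *)
Lemma slead1 a f : dindex a = 1%N -> lead a f -> slead a f.
Proof.
move=> a1 lf b /lf /orP[//|/andP[_]]; rewrite a1.
by have [->|[-> _]] := dindexP b.
Qed.

(** Multiplication identifies the two basis elements with a given word of
    length two, but it respects the strict order of words; this is why f has
    to be strong. *)
Lemma slead_diprod c a b f : slead a f ->
  slead (mon_prod c a b) (diprod c f (dmon b)).
Proof.
rewrite /slead => sf; rewrite -diprod_dmon -bilinBl.
apply: supp_in_bilin sf (supp_in_dmon (erefl b)) => a' _ /= lt_a' <-.
by rewrite !dword_prod; apply: lt_mul.
Qed.

End LeadingTerms.

(** * Spans of normal polynomials *)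

Section NormalSpans.
Context {k : fieldType} {X : choiceType}.
Context (le : rel (cword X)) (hle : monomial_order le).
Local Notation D := (Di k X).
Context (S : set D) (hS : monic_set le S).
Local Notation lt := (wlt le).
Local Notation mclt := (mclt le).
Local Notation lm := (@lm k X le).
Local Notation normal := (normal_S_poly le S).
Local Notation lead := (@lead k X le).
Local Notation slead := (@slead k X le).
Local Notation below w := (fun b : dimon X => lt (dword b) w).
Local Notation upto w := (fun b : dimon X => le (dword b) w).
Implicit Types (f g h p q s : D) (a b : dimon X) (u v w : cword X) (x : X).
Implicit Types (P Q : dimon X -> Prop) (c : bool).

(** A linear combination whose terms all have their leading monomial in P:
    the bound is on the terms before any cancellation, which for a P closed
    downwards is more than a bound on the support of the sum. *)
Inductive nspan P : D -> Prop :=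
| nspan0 : nspan P 0
| nspan_cons z p f a : normal p -> lead a p -> P a -> nspan P f ->
    nspan P (z *: p + f).

Lemma nspan1 P a p : normal p -> lead a p -> P a -> nspan P p.
Proof.
move=> np lp Pa; rewrite -[p](addr0) -[p](scale1r).
exact: nspan_cons np lp Pa (nspan0 P).
Qed.

Lemma nspanW P Q f : (forall a, P a -> Q a) -> nspan P f -> nspan Q f.
Proof.
move=> PQ; elim=> [|z p g a np lp Pa _ IHg]; first exact: nspan0.
by apply: nspan_cons np lp _ IHg; apply: PQ.
Qed.

Lemma nspanD P f g : nspan P f -> nspan P g -> nspan P (f + g).
Proof.
move=> Pf Pg; elim: Pf => [|z p h a np lp Pa _ IHh]; first by rewrite add0r.
by rewrite -addrA; apply: nspan_cons np lp Pa IHh.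
Qed.

Lemma nspanZ P (z : k) f : nspan P f -> nspan P (z *: f).
Proof.
elim=> [|z' p h a np lp Pa _ IHh]; first by rewrite scaler0; apply: nspan0.
by rewrite scalerDr scalerA; apply: nspan_cons np lp Pa IHh.
Qed.

Lemma nspanB P f g : nspan P f -> nspan P g -> nspan P (f - g).
Proof. by move=> Pf Pg; rewrite -(scaleN1r g); apply/nspanD/nspanZ. Qed.

Lemma nspanBC P f g : nspan P (f - g) -> nspan P (g - f).
Proof. by move/(nspanB (nspan0 P)); rewrite sub0r opprB. Qed.

Lemma nspan_sum P I (s : seq I) (z : I -> k) (F : I -> D) :
  (forall i, z i != 0 -> nspan P (F i)) ->
  nspan P (\sum_(i <- s) z i *: F i).
Proof.
move=> PF; elim: s => [|i s IHs]; first by rewrite big_nil; apply: nspan0.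
rewrite big_cons; apply: nspanD IHs; have [->|/PF] := eqVneq (z i) 0.
  by rewrite scale0r; apply: nspan0.
exact: nspanZ.
Qed.

Lemma nspan_Id P f : nspan P f -> Id S f.
Proof.
move=> Pf J idJ sSJ; elim: Pf => [|z p g a np _ _ _ Jg].
  exact: ideal0 idJ.
apply: (idealD idJ) Jg; apply: (idealZ idJ).
have [s [b [m [/sSJ Js []]]]] := np => // *; first exact: (ideal_vdashr idJ).
exact: (ideal_dashvr idJ).
Qed.

Lemma lsizeE a s : lead a s -> lsize le s = mdeg (cword_val (dword a)).
Proof. by move=> ls; rewrite /lsize /lw (lead_lm hle ls). Qed.

Lemma lindexE a s : lead a s -> lindex le s = dindex a.
Proof. by move=> ls; rewrite /lindex (lead_lm hle ls). Qed.

Lemma normal_self s : S s -> normal s.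
Proof. by move=> Ss; exists s, 1%M, (lindex le s); split=> //; constructor. Qed.

Lemma normal_dashv s a u : S s -> slead a s -> normal (s ⊣ dmon (mon1 u)).
Proof.
move=> Ss ls; exists s, (cword_val u), 1%N; split=> //; constructor.
exact/(strongP hle (slead_lead ls)).
Qed.

Lemma normal_vdash s a x : S s -> slead a s ->
  mdeg (cword_val (dword a)) = 1%N -> normal (s ⊢ gen x).
Proof.
move=> Ss ls a1; exists s, (ucm x), 2%N; split=> //; constructor.
by rewrite (lsizeE (slead_lead ls)).
Qed.

Lemma lead_inj a b f : lead a f -> lead b f -> a = b.
Proof. by move=> /(lead_lm hle) la /(lead_lm hle); rewrite la => -[]. Qed.

Variant normal_spec a p : Prop :=
| NormalSelf of S p
| NormalVdashLetter s y x of S s & slead (letter y) s &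
    p = s ⊢ gen x & a = mon_vdash (letter y) (letter x)
| NormalDashvWord s b u of S s & slead b s &
    p = s ⊣ dmon (mon1 u) & a = mon_dashv b (mon1 u).

Lemma normal_S_polyP p : normal p -> exists2 a, lead a p & normal_spec a p.
Proof.
move=> [s [b [m [Ss ns]]]]; have [a ls] := monic_lead hle (hS Ss).
case: ns => [|x s1|u st]; first by exists a => //; apply: NormalSelf.
- rewrite (lsizeE ls) in s1; have [y ay] := dimon_letter s1.
  rewrite {}ay {a s1} in ls.
  have sls : slead (letter y) s by apply: slead1.
  exists (mon_vdash (letter y) (letter x)).
    exact: (slead_lead (slead_diprod hle (c := true) (b := letter x) sls)).
  exact: NormalVdashLetter Ss sls erefl erefl.
- have sls := (strongP hle ls).1 st.
  exists (mon_dashv a (mon1 u)); last exact: NormalDashvWord Ss sls erefl erefl.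
  exact: (slead_lead (slead_diprod hle (c := false) (b := mon1 u) sls)).
Qed.

Lemma normal_S_poly_leadP a p : normal p -> lead a p -> normal_spec a p.
Proof. by move=> /normal_S_polyP[b lb nb] la; rewrite (lead_inj la lb). Qed.

Lemma supp_in_upto a p : lead a p -> supp_in (upto (dword a)) p.
Proof.
move=> lp b /(lead_max lp).2[->|/(mclt_le hle)//]; exact: le_refl.
Qed.

Lemma supp_in_uptoM c w b f : supp_in (upto w) f ->
  supp_in (upto (cwmul w (dword b))) (diprod c f (dmon b)).
Proof.
move=> wf; apply: supp_in_bilin wf (supp_in_dmon (erefl b)) => a _ wa <-.
by rewrite dword_prod; apply: le_mul.
Qed.

Definition downclosed P : Prop := forall a b, mclt a b -> P b -> P a.

Lemma upto_downclosed w : downclosed (upto w).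
Proof. by move=> a b /(mclt_le hle) ab; apply: le_trans ab. Qed.

Lemma below_downclosed w : downclosed (below w).
Proof. by move=> a b /(mclt_le hle); apply: le_lt_trans. Qed.

Lemma mclt_downclosed a : downclosed (fun b => mclt b a).
Proof. by move=> b b' bb'; apply: mclt_trans. Qed.

Lemma lm_supp a f : lm f = Some a -> f@_a != 0.
Proof.
move=> fa; have [|b [+ fb _]] := @lm_max _ _ _ hle f.
  by move=> f0; rewrite f0 lm0 in fa.
by rewrite fa => -[->].
Qed.

(** Triviality bounds the terms by the leading monomial of h, which lies in P
    as soon as the support does. *)
Lemma trivial_nspan P h : downclosed P -> supp_in P h ->
  trivial_mod le S h -> nspan P h.
Proof.
move=> dP Ph [n [z [p [hE np lmp]]]]; rewrite hE; apply: nspan_sum => i zi.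
have [a lp _] := normal_S_polyP (np i); apply: (nspan1 (np i) lp).
have [|] := lmp i zi; rewrite (lead_lm hle lp).
  by move/esym/lm_supp/Ph.
by case Eh: (lm h) => [b|//] /dP; apply; apply/Ph/lm_supp.
Qed.

(** * Products of normal polynomials *)

Section Products.
Hypothesis GS : forall h, composition le S h -> trivial_mod le S h.

Lemma comp_nspan P h : downclosed P -> supp_in P h -> composition le S h ->
  nspan P h.
Proof. by move=> dP Ph /GS; apply: trivial_nspan. Qed.

(** All words occurring on the left have length at least three. *)
Lemma diprod_dmon2 c c' f a b :
  diprod c (diprod c' f (dmon a)) (dmon b) =
  f ⊣ dmon (mon1 (cwmul (dword a) (dword b))).
Proof.
rewrite -diprodF; move: f; apply: eq_linear_dmon => [z f g||e].
- by rewrite /diprod !bilin_linearl.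
- exact: bilin_linearl.
rewrite !diprod_dmon; congr dmon; case: c c' => [] [];
  rewrite /= /mon_vdash /mon_dashv /= -cwmulA //; exact: mon2_mul3.
Qed.

(** This is where multiplication and special compositions are used. For s in S
    not strong the products by x are compositions. For s strong, s ⊣ x is
    normal, and so is s ⊢ x when the leading word is a letter; otherwise the
    two products differ by a special composition, or agree when no letter
    occurs in s. *)
Lemma nspan_diprod_letter c a p x : normal p -> lead a p ->
  nspan (upto (cwmul (dword a) (cwU x))) (diprod c p (gen x)).
Proof.
move=> np lp.
have [Sp|s y x' Ss ls -> ->|s b u Ss ls -> ->] := normal_S_poly_leadP np lp.
- have supp c' := supp_in_uptoM (c := c') (b := letter x) (supp_in_upto lp).
  have [/(strongP hle lp) sp|nsp] := pselect (strong le p); last first.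
    apply: comp_nspan => //; first exact: upto_downclosed.
    by case: c; [apply: MulCompVdash|apply: MulCompDashv].
  have nF : nspan (upto (cwmul (dword a) (cwU x))) (diprod false p (gen x)).
    apply: (nspan1 _
      (slead_lead (slead_diprod hle (c := false) (b := letter x) sp))).
      exact: normal_dashv Sp sp.
    exact: le_refl.
  case: c; last exact: nF.
  have [a1|a_gt1] := cword_mdeg_cases (dword a); last first.
  + rewrite -[diprod _ _ _](subrK (diprod false p (gen x))).
    apply: nspanD; last exact: nF.
    have [ex_letter|no_letter] := pselect (exists y, letter y \in msupp p).
      apply: comp_nspan; first exact: upto_downclosed.
        exact: supp_inB.
      apply: SpecialComp => //; first exact/(strongP hle lp).
      by rewrite (lsizeE lp).
    suff -> : diprod true p (gen x) = diprod false p (gen x).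
      by rewrite subrr; apply: nspan0.
    have E c := linear_sum_dmon p (bilin_linearl (mon_prod c) (gen x)).
    rewrite /diprod [LHS](E true) [RHS](E false); apply: eq_big_seq => b bp.
    rewrite !bilin_dmon /mon_prod; congr (_ *: dmon _).
    rewrite /mon_vdash /mon_dashv mon2_gt2 //= mdegM mdegU addn1 ltnS.
    rewrite ltn_neqAle mdeg_cword_gt0 andbT; apply/eqP => /esym b1.
    have [y by_] := dimon_letter b1.
    by apply: no_letter; exists y; rewrite -by_.
  + apply: (nspan1 _
      (slead_lead (slead_diprod hle (c := true) (b := letter x) sp))).
      exact: normal_vdash Sp sp a1.
    exact: le_refl.
- rewrite -[s ⊢ _]/(diprod true s _) diprod_dmon2.
  apply: (nspan1 _
      (slead_lead (slead_diprod hle (c := false) (b := mon1 _) ls))).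
    exact: normal_dashv Ss ls.
  by rewrite dword_prod /= cwmulA; apply: le_refl.
- rewrite -[s ⊣ _]/(diprod false s _) diprod_dmon2.
  apply: (nspan1 _
      (slead_lead (slead_diprod hle (c := false) (b := mon1 _) ls))).
    exact: normal_dashv Ss ls.
  by rewrite dword_prod /= cwmulA; apply: le_refl.
Qed.

Lemma nspan_diprod P Q c b h :
  (forall a p, normal p -> lead a p -> P a -> nspan Q (diprod c p (dmon b))) ->
  nspan P h -> nspan Q (diprod c h (dmon b)).
Proof.
move=> PQ; elim=> [|z p f a np lp Pa _ IHf].
  by rewrite /diprod bilin0l; apply: nspan0.
by rewrite /diprod bilin_linearl; apply/nspanD/IHf/nspanZ/PQ/Pa.
Qed.

(** A word of length at least two is a product of letters, and associativity
    reduces the product by it to successive products by its letters. *)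
Lemma nspan_diprod_dmon c a b p : normal p -> lead a p ->
  nspan (upto (cwmul (dword a) (dword b))) (diprod c p (dmon b)).
Proof.
have [b1|b_gt1] := cword_mdeg_cases (dword b).
  by have [x ->] := dimon_letter b1; apply: nspan_diprod_letter.
rewrite (@diprod_long _ _ c false p b (mon1 (dword b))) // => {b_gt1}.
move: (dword b) => v.
elim/(@cword_ind_letter X): v a p => [x|x u IHu] a p np lp.
  exact: nspan_diprod_letter.
have -> : diprod false p (dmon (mon1 (cwmul (cwU x) u))) =
    diprod false (diprod false p (gen x)) (dmon (mon1 u)).
  by rewrite diprod_dmon2.
apply: nspan_diprod (nspan_diprod_letter false x np lp) => e q nq lq we.
apply: nspanW (IHu e q nq lq) => e' we'; apply: (le_trans hle we').
by rewrite cwmulA; apply: le_mul.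
Qed.

Lemma nspan_below_diprod c w b h : nspan (below w) h ->
  nspan (below (cwmul w (dword b))) (diprod c h (dmon b)).
Proof.
apply: nspan_diprod => a p np lp wa.
apply: nspanW (nspan_diprod_dmon c b np lp) => e we.
by apply: (le_lt_trans hle we); apply: lt_mul.
Qed.

Lemma nspan_below_dashw w w' m h : (cword_val w' = cword_val w * m)%M ->
  nspan (below w) h -> nspan (below w') (dashw h m).
Proof.
have [->|[u ->]] := dashwP m => w'E wh.
  by rewrite dashw1 (_ : w' = w) //; apply: cword_val_inj; rewrite mulm1 in w'E.
rewrite dashwE (_ : w' = cwmul w u); last exact: cword_val_inj.
exact: (nspan_below_diprod false (mon1 u)).
Qed.

Lemma nspan_diprod_below c a p w r : normal p -> lead a p ->
  supp_in (below w) r -> nspan (below (cwmul (dword a) w)) (diprod c p r).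
Proof.
move=> np lp wr; rewrite /diprod (linear_sum_dmon r (bilin_linearr _ p)).
apply: (@nspan_sum _ _ _ (fun b => r@_b)) => b /wr wb.
apply: nspanW (nspan_diprod_dmon c b np lp) => e we.
apply: (le_lt_trans hle we).
by rewrite !(cwmulC (dword a)); apply: lt_mul.
Qed.

(** Let f' and g' be the tails of f and g. Since f g = g f, the difference is
    g f' - f g', where f times a monomial of g' and g times a monomial of f'
    have leading words below the product of the leading words. So coprime
    leading words call for no composition. *)
Lemma nspan_swap c f g a b : S f -> S g -> slead a f -> slead b g ->
  nspan (below (cwmul (dword a) (dword b)))
    (diprod c f (dmon b) - diprod c g (dmon a)).
Proof.
move=> Sf Sg lf lg.
have -> : diprod c f (dmon b) - diprod c g (dmon a) =
    diprod c g (f - dmon a) - diprod c f (g - dmon b).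
  rewrite /diprod !bilinBr -!/(diprod _ _ _) (diprodC c f g) opprB.
  by rewrite [RHS]addrC addrA subrK.
apply: nspanB; last first.
  exact: nspan_diprod_below (normal_self Sf) (slead_lead lf) lg.
rewrite cwmulC.
exact: nspan_diprod_below (normal_self Sg) (slead_lead lg) lf.
Qed.

Lemma Id_nspan f : Id S f -> nspan (fun=> True) f.
Proof.
pose T : dimon X -> Prop := fun=> True.
have mulT c h g : nspan T h -> nspan T (diprod c h g).
  move=> Th; rewrite /diprod (linear_sum_dmon g (bilin_linearr _ h)).
  apply: (@nspan_sum _ _ _ (fun b => g@_b)) => b _.
  apply: nspan_diprod Th => a p np lp _.
  by apply: nspanW (nspan_diprod_dmon c b np lp).
apply; last first.
  move=> s Ss; have [a ls] := monic_lead hle (hS Ss).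
  exact: nspan1 (normal_self Ss) ls I.
split=> [|g h|z g|g h Th|g h|g h Th|g h].
- exact: nspan0.
- exact: nspanD.
- exact: nspanZ.
- by rewrite vdashC; apply: (mulT true).
- exact: (mulT true).
- by rewrite dashvC; apply: (mulT false).
- exact: (mulT false).
Qed.

End Products.
End NormalSpans.

(** * Normal polynomials with equal leading monomials *)

Section Overlaps.
Context {k : fieldType} {X : choiceType}.
Context (le : rel (cword X)) (hle : monomial_order le).
Local Notation D := (Di k X).
Context (S : set D) (hS : monic_set le S).
Local Notation lt := (wlt le).
Local Notation mclt := (mclt le).
Local Notation lm := (@lm k X le).
Local Notation normal := (normal_S_poly le S).
Local Notation lead := (@lead k X le).
Local Notation slead := (@slead k X le).
Local Notation below w := (fun b : dimon X => lt (dword b) w).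
Local Notation nspan := (@nspan k X le S).
Implicit Types (f g h p q s : D) (a b : dimon X) (u v w : cword X) (x : X).
Implicit Types (P Q : dimon X -> Prop) (c : bool) (m : {cmonom X}).
Hypothesis GS : forall h, composition le S h -> trivial_mod le S h.

(** Either f = g, or f - g is an equal composition. *)
Lemma nspan_equal P a f g : S f -> S g -> lead a f -> lead a g ->
  downclosed le P -> supp_in P (f - g) -> nspan P (f - g).
Proof.
move=> Sf Sg lf lg dP Pfg; have [->|nfg] := pselect (f = g).
  by rewrite subrr; apply: nspan0.
apply: (comp_nspan hle hS GS dP Pfg); apply: EqualComp => //.
by rewrite (lead_lm hle lf) (lead_lm hle lg).
Qed.

Lemma short_intersection_comp c f g a b x :
  S f -> S g -> lead a f -> lead b g ->
  mdeg (cword_val (dword b)) = 1%N -> a = mon_prod c b (letter x) ->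
  composition le S (f - diprod c g (gen x)).
Proof.
move=> Sf Sg lf lg b1 ab.
have sg : slead b g.
  by apply: slead1 lg; have [y ->] := dimon_letter b1.
have lm_p : lm (diprod c g (gen x)) = Some a.
  rewrite ab; apply: (lead_lm hle (slead_lead _)).
  exact: (slead_diprod hle (c := c) (b := letter x) sg).
have g1 : lsize le g = 1%N by rewrite (lsizeE hle lg).
apply: (@ShortInterComp _ _ _ _ f g x (if c then 2%N else 1%N)) => //.
- by rewrite (lsizeE hle lf) ab dword_prod mdegM mdegU b1.
- case: (c); first exact: NormalVdash.
  exact: (@NormalDashv _ _ _ _ (cwU x) ((strongP hle lg).2 sg)).
- by rewrite (lead_lm hle lf) lm_p.
Qed.

Lemma slead_dashw a f m w : slead a f -> (m = 1%M -> dindex a = 1%N) ->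
  cword_val w = (cword_val (dword a) * m)%M -> slead (mon1 w) (dashw f m).
Proof.
have [->|[u ->]] := dashwP m => sf a1 wE.
  rewrite dashw1 (_ : mon1 w = a) //; apply: dimonP => /=; last by rewrite a1.
  by apply: cword_val_inj; rewrite mulm1 in wE.
rewrite dashwE (_ : mon1 w = mon_prod false a (mon1 u)).
  exact: (slead_diprod hle (c := false) (b := mon1 u) sf).
by congr mon1; apply: cword_val_inj.
Qed.

Lemma normal_poly_dashw a f m : slead a f -> (m = 1%M -> dindex a = 1%N) ->
  normal_poly le f m 1 (dashw f m).
Proof.
move=> sf; have lf := slead_lead sf; have [->|[u ->] _] := dashwP m => [a1|].
  by rewrite dashw1 -(a1 erefl) -(lindexE hle lf); constructor.
by rewrite dashwE; constructor; apply/(strongP hle lf).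
Qed.

Lemma dashv_dword f a b : dword a = dword b -> f ⊣ dmon a = f ⊣ dmon b.
Proof.
move=> eqab; rewrite -[LHS]/(diprod false _ _) -[RHS]/(diprod false _ _).
move: f; apply: eq_linear_dmon => [||e]; try exact: bilin_linearl.
by rewrite [LHS]diprod_dmon [RHS]diprod_dmon /mon_prod /mon_dashv eqab.
Qed.

(** The difference at the least common multiple w0, further multiplied by t.
    When w0 is the product of the two leading words, [nspan_swap] applies;
    when the lengths of the leading words add up to more than three, the
    difference is a long intersection composition. What remains is a word of
    length two and one of its letters, as n is not empty: then a short
    intersection composition is available. When a has subscript 2 that
    composition is f - g ⊢ x rather than f - g ⊣ x, which makes no difference
    after multiplication by a nonempty t. *)
Lemma nspan_lcm_overlap f g a b w (w0 m n t : {cmonom X}) :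
  S f -> S g -> slead a f -> slead b g -> dword a <> dword b ->
  is_lcm (cword_val (dword a)) (cword_val (dword b)) w0 ->
  w0 = (cword_val (dword a) * m)%M -> w0 = (cword_val (dword b) * n)%M ->
  n <> 1%M -> ((m * t)%M = 1%M -> dindex a = 1%N) -> cword_val w = (w0 * t)%M ->
  nspan (below w) (dashw f (m * t)%M - dashw g (n * t)%M).
Proof.
move=> Sf Sg sf sg neq_ab lcm_w0 w0a w0b n1 a1 wE.
have [lf lg] := (slead_lead sf, slead_lead sg).
have [_ _ w0min] := lcm_w0.
have [u w0u] : exists u, w0 = cword_val u.
  have w0_neq1 : w0 != 1%M.
    by rewrite w0a; apply: contra (valP (dword a)) => /unitmP[->].
  by exists (CWord w0_neq1).
have degA := mdeg_cword_gt0 (dword a); have degB := mdeg_cword_gt0 (dword b).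
have degn : (0 < mdeg n)%N by rewrite lt0n mdeg_eq0; apply/eqP.
have degw0a : mdeg w0 = (mdeg (cword_val (dword a)) + mdeg m)%N.
  by rewrite w0a mdegM.
have degw0b : mdeg w0 = (mdeg (cword_val (dword b)) + mdeg n)%N.
  by rewrite w0b mdegM.
have [z zE] : cmdvd w0 (cword_val (dword a) * cword_val (dword b))%M.
  apply: w0min; first by exists (cword_val (dword b)).
  by exists (cword_val (dword a)); apply: mulmC.
have degz : (mdeg (cword_val (dword a)) + mdeg (cword_val (dword b)) =
    mdeg w0 + mdeg z)%N by rewrite -!mdegM zE.
have w_u : cword_val w = (cword_val u * t)%M by rewrite -w0u.
have [z0|z_gt0] := posnP (mdeg z).
  have z1 := mdeg_eq0I z0; rewrite z1 mulm1 in zE.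
  have mE : m = cword_val (dword b).
    by apply: (@cm_mulI _ (cword_val (dword a))); rewrite -w0a.
  have nE : n = cword_val (dword a).
    by apply: (@cm_mulI _ (cword_val (dword b))); rewrite -w0b -zE mulmC.
  rewrite !dashwM -dashwB; apply: (nspan_below_dashw hle hS GS w_u).
  rewrite mE nE !dashwE (dashv_dword f (b := b)) // (dashv_dword g (b := a)) //.
  have -> : u = cwmul (dword a) (dword b).
    by apply: cword_val_inj; rewrite /= zE.
  exact: (nspan_swap hle hS GS false Sf Sg sf sg).
have [lt3|le3] :=
  ltnP 3 (mdeg (cword_val (dword a)) + mdeg (cword_val (dword b))).
  (* If m is empty then a has the word w0; a subscript 2 would force the
     lengths 2 and 1 for the two words. *)
  have m1 : m = 1%M -> dindex a = 1%N.
    move=> m1; have [//|[_ a2]] := dindexP a.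
    by exfalso; move: degw0a; rewrite m1 mdeg1; lia.
  have fm := slead_dashw (w := u) sf m1.
  have gn := slead_dashw (w := u) (m := n) sg.
  rewrite !dashwM -dashwB; apply: (nspan_below_dashw hle hS GS w_u).
  apply: (comp_nspan hle hS GS); first exact: below_downclosed.
    by apply: (@sleadB _ _ _ (mon1 u)); [apply: fm|apply: gn]; rewrite -?w0u.
  apply: (@LongInterComp _ _ _ _ f g (dword a) (dword b) m n w0) => //.
  - exact/(strongP hle lf).
  - exact/(strongP hle lg).
  - by rewrite (lsizeE hle lf) (lsizeE hle lg).
  - rewrite (lead_lm hle lf) (lead_lm hle lg) => -[ab].
    by apply: neq_ab; rewrite ab.
  - by rewrite /lw (lead_lm hle lf).
  - by rewrite /lw (lead_lm hle lg).
  - by rewrite (lsizeE hle lf) (lsizeE hle lg); lia.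
  - exact: normal_poly_dashw sf m1.
  - exact: (normal_poly_dashw sg).
have b1 : mdeg (cword_val (dword b)) = 1%N by lia.
have m0 : m = 1%M by apply: mdeg_eq0I; lia.
have [x nx] : exists x, n = ucm x.
  have [//|[v nv]] := dashwP n.
  have [x vx] : exists x, v = cwU x by apply: cword_mdeg1; rewrite -nv; lia.
  by exists x; rewrite nv vx.
have ua : u = dword a.
  by apply: cword_val_inj; rewrite w0a m0 mulm1 in w0u.
have ab : dword a = cwmul (dword b) (cwU x).
  by apply: cword_val_inj; rewrite -ua -w0u w0b nx.
(* c selects the product for which g times x has the leading monomial a. *)
have [c [aE ct]] : exists c, a = mon_prod c b (letter x) /\ (c -> t <> 1%M).
  have [a_1|[a_2 _]] := dindexP a.
    by exists false; split=> //; apply: dimonP.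
  exists true; split=> [|_ t1]; last first.
    by move: a_2; rewrite a1 // m0 t1 mulm1.
  by rewrite [LHS]mon2E // ab.
have -> : dashw g (n * t)%M = dashw (diprod c g (gen x)) t.
  rewrite nx; case: c ct {aE} => [/(_ isT)|_]; last first.
    by rewrite dashwM -[ucm x]/(cword_val (cwU x)) dashwE.
  have [//|[v ->] _] := dashwP t.
  rewrite -[(_ * _)%M]/(cword_val (cwmul (cwU x) v)) !dashwE.
  by rewrite -[RHS]diprodF diprod_dmon2.
rewrite m0 mul1m -dashwB; apply: (nspan_below_dashw hle hS GS w_u).
rewrite ua; apply: (comp_nspan hle hS GS); first exact: below_downclosed.
  have := slead_diprod hle (c := c) (b := letter x) sg.
  by rewrite -aE => /(sleadB sf).
exact: short_intersection_comp Sf Sg lf lg b1 aE.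
Qed.

(** If the leading words of f and g differ, factor w through their least common
    multiple, exchanging f and g if the cofactor of g is trivial. If they
    agree, so do m and n; then either f - g is an equal composition, or the
    leading monomials have the same word and different subscripts, m is not
    empty, and splitting off one letter of m gives an equal multiplication
    composition. *)
Lemma nspan_overlap f g a b w (m n : {cmonom X}) :
  S f -> S g -> slead a f -> slead b g ->
  (m = 1%M -> dindex a = 1%N) -> (n = 1%M -> dindex b = 1%N) ->
  cword_val w = (cword_val (dword a) * m)%M ->
  cword_val w = (cword_val (dword b) * n)%M ->
  nspan (below w) (dashw f m - dashw g n).
Proof.
move=> Sf Sg sf sg a1 b1 wa wb; have [lf lg] := (slead_lead sf, slead_lead sg).
have [eqw|/eqP neqw] := eqVneq (dword a) (dword b); last first.
  have [w0 [m' [n' [t [lcm_w0 w0a w0b mE nE]]]]] :=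
    cm_lcm (etrans (esym wa) wb).
  rewrite mE in wa a1 *; rewrite nE in wb b1 *.
  have [n'1|/eqP n'1] := eqVneq n' 1%M; last first.
    apply: nspan_lcm_overlap lcm_w0 _ _ _ _ _ => //.
    by rewrite wa w0a mulmA.
  apply: nspanBC; apply: (nspan_lcm_overlap Sg Sf sg sf _ _ w0b w0a _ b1).
  - exact/nesym.
  - by case: lcm_w0 => wA wB wmin; split=> // z zB zA; apply: wmin.
  - move=> m'1; apply: neqw; apply: cword_val_inj.
    by move: w0b; rewrite w0a n'1 m'1 !mulm1.
  - by rewrite wa w0a mulmA.
have mn : m = n.
  by apply: (@cm_mulI _ (cword_val (dword a))); rewrite -wa wb eqw.
rewrite -{n}mn in b1 wb *.
have [eqab|/eqP neqab] := eqVneq a b.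
  rewrite -dashwB; apply: (nspan_below_dashw hle hS GS wa).
  rewrite -eqab in sg lg; apply: (nspan_equal Sf Sg lf lg).
    exact: below_downclosed.
  exact: sleadB.
have [m1|/eqP m1] := eqVneq m 1%M.
  by case: neqab; apply: dimonP => //; rewrite a1 ?b1.
have /cm_factor[x [t mE]] : m != 1%M by apply/eqP.
rewrite mE in wa *; rewrite !dashwM -dashwB.
apply: (@nspan_below_dashw _ _ _ hle _ hS GS (cwmul (dword a) (cwU x))).
  by rewrite wa /= mulmA.
apply: (comp_nspan hle hS GS); first exact: below_downclosed.
  apply: (@sleadB _ _ _ (mon1 (cwmul (dword a) (cwU x)))).
    apply: (slead_dashw sf) => // x1.
    by have := cwU_subproof x; rewrite x1 eqxx.
  apply: (slead_dashw sg); last by rewrite eqw.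
  by move=> x1; have := cwU_subproof x; rewrite x1 eqxx.
have x_1 : ucm x <> 1%M by apply/eqP/cwU_subproof.
apply: (@EqualMulComp _ _ _ _ f g x) => //.
- exact/(strongP hle lf).
- exact/(strongP hle lg).
- rewrite (lsizeE hle lf) (lsizeE hle lg) -eqw addnn.
  have [a_1|[_ ->]//] := dindexP a; have [b_1|[_]] := dindexP b.
    by case: neqab; apply: dimonP => //; rewrite a_1 b_1.
  by rewrite -eqw => ->.
- by rewrite (lead_lm hle lf) (lead_lm hle lg) => -[].
- by rewrite /lw (lead_lm hle lf) (lead_lm hle lg) /= eqw.
- exact: (normal_poly_dashw sf).
- exact: (normal_poly_dashw sg).
Qed.

(** A normal polynomial s ⊢ x has subscript 2, and an element of S whose leading
    monomial has subscript 1 is strong. *)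
Lemma normal_index1 a p : normal p -> lead a p -> dindex a = 1%N ->
  exists s b m, [/\ S s, slead b s, p = dashw s m, m = 1%M -> dindex b = 1%N
    & cword_val (dword a) = (cword_val (dword b) * m)%M].
Proof.
move=> np lp.
have [Sp|s y x _ _ _ ->|s b u Ss sb -> ->] :=
  normal_S_poly_leadP hle hS np lp => a1.
- exists p, a, 1%M; rewrite dashw1 mulm1; split=> //; exact: slead1 lp.
- by move: a1; rewrite /dindex /= mdegM !mdegU.
- exists s, b, (cword_val u); rewrite dashwE; split=> // u1.
  by have := valP u; rewrite /= u1 eqxx.
Qed.

Lemma letter_pair (x y x' y' : X) :
  cwmul (cwU x) (cwU y) = cwmul (cwU x') (cwU y') ->
  (x = x' /\ y = y') \/ (x = y' /\ y = x').
Proof.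
have cwU_inj (z z' : X) : cwU z = cwU z' -> z = z'.
  move=> eqz; have /= /eqP/cmP/(_ z) := congr1 (@cword_val X) eqz.
  by rewrite !cmU eqxx; case: eqP.
move=> eqw; have [xx'|neqx] := eqVneq x x'; [left|right].
  by split=> //; apply/cwU_inj/(@cwmulI _ (cwU x)); rewrite eqw xx'.
have xy' : y' = x.
  have /= /eqP/cmP/(_ x) := congr1 (@cword_val X) eqw.
  by rewrite !cmM !cmU eqxx (eq_sym x') (negPf neqx); case: (eqVneq y' x).
split=> //; apply/cwU_inj/(@cwmulI _ (cwU x)).
by rewrite eqw xy' cwmulC.
Qed.

(** For the subscript 1 this is [nspan_overlap]. For the subscript 2 each of p
    and q is in S or of the form s ⊢ x with a letter as leading word of s.
    Two elements of S give an equal composition, a mixed pair gives a short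
    intersection composition. Two products s ⊢ x and s' ⊢ x' with the same
    leading word either have the same letters in the same roles, and s - s' is
    an equal composition, or the letters are exchanged and [nspan_swap]
    applies. *)
Lemma nspan_same_lead a p q : normal p -> normal q -> lead a p -> lead a q ->
  nspan (fun b => mclt b a) (p - q).
Proof.
have shortP f s y x : S f -> S s -> lead a f -> slead (letter y) s ->
    a = mon_vdash (letter y) (letter x) ->
    nspan (fun b => mclt b a) (f - s ⊢ gen x).
  move=> Sf Ss lf ls aE; apply: (comp_nspan hle hS GS).
  - exact: mclt_downclosed.
  - apply: (leadB lf); rewrite aE.
    exact: (slead_lead (slead_diprod hle (c := true) (b := letter x) ls)).
  - apply: (short_intersection_comp (c := true) Sf Ss lf (slead_lead ls)) aE.
    exact: mdegU.
move=> np nq lp lq; have [a1|[a2 _]] := dindexP a.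
  have [s [b [m [Ss sb -> mb wb]]]] := normal_index1 np lp a1.
  have [s' [b' [m' [Ss' sb' -> mb' wb']]]] := normal_index1 nq lq a1.
  have := nspan_overlap Ss Ss' sb sb' mb mb' wb wb'.
  by apply: nspanW => e; apply: mclt_wlt.
have [Sp|s y x Ss ls pE aE|s b u _ _ _ aE] :=
  normal_S_poly_leadP hle hS np lp; last first.
- by move: a2; rewrite aE.
- have [Sq|s' y' x' Ss' ls' qE aE'|s' b' u' _ _ _ aE'] :=
    normal_S_poly_leadP hle hS nq lq; last first.
  + by move: a2; rewrite aE'.
  + rewrite {}pE {}qE; have := congr1 dword aE.
    rewrite {1}aE' => /letter_pair wE.
    apply: (@nspanW _ _ _ _ (below (dword a))) => [e|]; first exact: mclt_wlt.
    rewrite aE; case: wE => -[yE xE]; subst y' x'.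
      have below_y : nspan (below (cwU y)) (s - s').
        apply: (nspan_equal Ss Ss' (slead_lead ls) (slead_lead ls')).
          exact: below_downclosed.
        exact: (sleadB ls ls').
      rewrite -vdashBl.
      exact: (nspan_below_diprod hle hS GS true (letter x) below_y).
    exact: (nspan_swap hle hS GS true Ss Ss' ls ls').
  + by rewrite pE; apply: nspanBC; exact: (shortP _ _ _ _ Sq Ss lq ls aE).
- have [Sq|s' y' x' Ss' ls' qE aE'|s' b' u' _ _ _ aE'] :=
    normal_S_poly_leadP hle hS nq lq; last first.
  + by move: a2; rewrite aE'.
  + by rewrite qE; exact: (shortP _ _ _ _ Sp Ss' lp ls' aE').
  + apply: (nspan_equal Sp Sq lp lq); first exact: mclt_downclosed.
    exact: leadB.
Qed.

End Overlaps.

(** * The Composition-Diamond lemma *)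

Lemma lincomb_exchange (k : fieldType) (V : lmodType k) (z z' : k) (p q g : V) :
  z *: p + (z' *: q + g) = (z + z') *: p + (z' *: (q - p) + g).
Proof.
rewrite scalerDl scalerBr -addrA; congr (_ + _).
by rewrite addrA [z' *: p + _]addrC subrK.
Qed.

Lemma lincomb_ord_cons (k : fieldType) (V : lmodType k) (z : k) (p : V) n
    (c : 'I_n -> k) (q : 'I_n -> V) :
  \sum_(i < n.+1) (if unlift ord0 i is Some j then c j else z) *:
    (if unlift ord0 i is Some j then q j else p) =
  z *: p + \sum_(i < n) c i *: q i.
Proof.
rewrite big_ord_recl unlift_none; congr (_ + _).
by apply: eq_bigr => i _; rewrite liftK.
Qed.

Section CompositionDiamond.
Context {k : fieldType} {X : choiceType}.
Context (le : rel (cword X)) (hle : monomial_order le).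
Local Notation D := (Di k X).
Context (S : set D) (hS : monic_set le S).
Local Notation mclt := (mclt le).
Local Notation mcle a := (fun b : dimon X => b = a \/ mclt b a).
Local Notation lm := (@lm k X le).
Local Notation normal := (normal_S_poly le S).
Local Notation lead := (@lead k X le).
Local Notation nspan := (@nspan k X le S).
Local Notation Irr := (Irr le S).
Implicit Types (f g h p q s r : D) (a b : dimon X) (P Q : dimon X -> Prop).

Definition Id_lm_normal : Prop :=
  forall f, f <> 0 -> Id S f -> exists h, normal h /\ lm f = lm h.

Lemma nspan_supp P f : downclosed le P -> nspan P f -> supp_in P f.
Proof.
move=> dP; elim=> [|z p g a _ lp Pa _ IHg]; first exact: supp_in0.
apply: supp_inD IHg; apply: supp_inZ => b /(lead_max lp).2[->//|ba].
exact: dP ba Pa.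
Qed.

(** A combination has finitely many terms, hence a largest leading monomial. *)
Lemma nspan_max P f : nspan P f -> f = 0 \/ exists2 b, P b & nspan (mcle b) f.
Proof.
elim=> [|z p g a np lp Pa _ [->|[b Pb bg]]]; first by left.
  right; exists a => //; apply: nspanD (nspan0 _ _ _).
  by apply: nspanZ; apply: (nspan1 np lp); left.
right; have [ab|lt_ab|lt_ba] := mclt_total hle a b.
- by exists b => //; apply: (nspan_cons _ np lp _ bg); left.
- by exists b => //; apply: (nspan_cons _ np lp _ bg); right.
exists a => //; apply: (nspan_cons _ np lp); first by left.
by apply: nspanW bg => c [->|cb]; right=> //; apply: (mclt_trans hle cb).
Qed.

Lemma lead_monic_normal h a : normal h -> lm h = Some a -> lead a h.
Proof.
move=> /(normal_S_polyP hle hS)[b lb _]; by rewrite (lead_lm hle lb) => -[<-].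
Qed.

Lemma supp_in_lm f a : lm f = Some a -> supp_in (mcle a) f.
Proof.
move=> fa b fb; have [|b' [fb' _ maxb']] := @lm_max _ _ _ hle f.
  by move=> f0; rewrite f0 lm0 in fa.
by move: fa; rewrite fb' => -[<-]; apply: maxb'.
Qed.

Lemma supp_in_cancel f h a : lm f = Some a -> lead a h ->
  supp_in (fun b => mclt b a) (f - f@_a *: h).
Proof.
move=> fa lh b; have [ha maxh] := lead_max lh.
have [->|neq] := eqVneq b a.
  by rewrite mcoeffB coeffZ ha mulr1 subrr eqxx.
have : supp_in (mcle a) (f - f@_a *: h).
  by apply: supp_inB; [apply: supp_in_lm|apply: supp_inZ => c /maxh].
by move=> sup /sup[ba|//]; rewrite ba eqxx in neq.
Qed.

Section GroebnerShirshovBasis.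
Hypothesis GS : forall h, composition le S h -> trivial_mod le S h.

(** Two terms with leading monomial a merge into one, up to smaller terms, by
    [nspan_same_lead]; so at most one such term remains. *)
Lemma nspan_split a f : nspan (mcle a) f ->
  nspan (fun b => mclt b a) f \/
  exists z p g, [/\ f = z *: p + g, normal p, lead a p
                  & nspan (fun b => mclt b a) g].
Proof.
elim=> [|z p g b np lp ba _ IHg]; first by left; apply: nspan0.
case: ba lp => [->|ba] lp; last first.
  case: IHg => [ag|[z' [q [g' [-> nq lq ag']]]]].
    by left; apply: (nspan_cons _ np lp).
  right; exists z', q, (z *: p + g').
  split; [exact: addrCA|exact: nq|exact: lq|exact: (nspan_cons _ np lp ba ag')].
right; case: IHg => [ag|[z' [q [g' [-> nq lq ag']]]]]; first by exists z, p, g.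
exists (z + z'), p, (z' *: (q - p) + g'); split; [|exact: np|exact: lp|].
  exact: lincomb_exchange.
by apply: nspanD ag'; apply: nspanZ; apply: (nspan_same_lead hle hS GS).
Qed.

(** By [nspan_split] either f lies in a smaller span, or f = z p + g with p the
    only term reaching a, and then z p cannot be cancelled by g. *)
Lemma GS_lm_normal f a : f <> 0 -> nspan (mcle a) f ->
  exists h, normal h /\ lm f = lm h.
Proof.
elim/(well_founded_ind (mclt_wf hle)): a f => a IHa f nz /nspan_split.
have lower g : g <> 0 -> nspan (fun b => mclt b a) g ->
    exists h, normal h /\ lm g = lm h.
  by move=> gnz /nspan_max[//|[b ba bg]]; apply: IHa bg.
case=> [|[z [p [g [fE np lp ag]]]]]; first exact: lower.
have [z0|nz_z] := eqVneq z 0.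
  by apply: lower => //; rewrite fE z0 scale0r add0r.
exists p; split=> //; rewrite (lead_lm hle lp).
have [pa maxp] := lead_max lp.
have sg := nspan_supp (mclt_downclosed hle (a := a)) ag.
apply: (lm_eq hle).
  rewrite fE mcoeffD coeffZ pa mulr1; have [->|/sg] := eqVneq (g@_a) 0.
    by rewrite addr0.
  by rewrite mcltxx.
rewrite fE; apply: supp_inD; first exact: supp_inZ.
by apply: supp_inW sg => b; right.
Qed.

Lemma GS_Id_lm_normal : Id_lm_normal.
Proof.
move=> f nz /(Id_nspan hle hS GS)/nspan_max[//|[a _ af]].
exact: GS_lm_normal nz af.
Qed.

End GroebnerShirshovBasis.

Lemma composition_Id h : composition le S h -> Id S h.
Proof.
have idI := Id_ideal S.
have nId p s (b : {cmonom X}) m : S s -> normal_poly le s b m p -> Id S p.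
  move=> /(@sub_Id _ _ S) Is []// *; first exact: (ideal_vdashr idI).
  exact: (ideal_dashvr idI).
have BId f g : Id S f -> Id S g -> Id S (f - g).
  move=> If Ig; rewrite -(scaleN1r g).
  by apply: (idealD idI If); apply: (idealZ idI).
case.
- by move=> f x /(@sub_Id _ _ S) If _; apply: (ideal_vdashr idI).
- by move=> f x /(@sub_Id _ _ S) If _; apply: (ideal_dashvr idI).
- move=> f x /(@sub_Id _ _ S) If _ _ _.
  by apply: BId; [apply: (ideal_vdashr idI)|apply: (ideal_dashvr idI)].
- by move=> f g /(@sub_Id _ _ S) If /(@sub_Id _ _ S) Ig _ _; apply: BId.
- move=> f g x m p /(@sub_Id _ _ S) If Sg _ _ /(nId _ _ _ _ Sg) Ip _.
  exact: BId.
- move=> f g x p q Sf Sg _ _ _ _ _ /(nId _ _ _ _ Sf) Ip /(nId _ _ _ _ Sg) Iq.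
  exact: BId.
- move=> f g u v a b w p q Sf Sg _ _ _ _ _ _ _ _ _ _ _ _.
  move=> /(nId _ _ _ _ Sf) Ip /(nId _ _ _ _ Sg) Iq; exact: BId.
Qed.

Lemma nspan_trivial a h :
  lm h = Some a -> nspan (mcle a) h -> trivial_mod le S h.
Proof.
move=> ha sh; rewrite /trivial_mod.
suff [n [z [p [-> np lp]]]] : exists n (z : 'I_n -> k) (p : 'I_n -> D),
    [/\ h = \sum_(i < n) z i *: p i, forall i, normal (p i)
      & forall i, lm_le le (p i) h] by exists n, z, p.
have : forall p b, lead b p -> mcle a b -> lm_le le p h.
  move=> p b lp; rewrite /lm_le ha (lead_lm hle lp).
  by case=> [->|ba]; [left|right].
(* The bound refers to the leading monomial of h itself, so it is kept aside
   while h is decomposed. *)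
move: {1 3}h => h0 le_h0.
elim: sh => [|z p g b np lp ba _ [n [c [q [-> nq lq]]]]].
  exists 0%N, (fun=> 0), (fun=> 0); split=> [|[]//|[]//].
  by rewrite big_ord0.
exists n.+1, (fun i => if unlift ord0 i is Some j then c j else z).
exists (fun i => if unlift ord0 i is Some j then q j else p); split.
- by rewrite lincomb_ord_cons.
- by move=> i; case: unliftP.
- by move=> i; case: unliftP => [j _|_]; [apply: lq|apply: (le_h0 p b)].
Qed.

(** Subtracting a multiple of a normal polynomial with the same leading
    monomial stays in the ideal and lowers the leading monomial. *)
Lemma Id_nspan_lm f a : Id_lm_normal -> Id S f -> lm f = Some a ->
  nspan (mcle a) f.
Proof.
move=> Hlm; elim/(well_founded_ind (mclt_wf hle)): a f => a IHa f If fa.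
have [|h [nh fh]] := Hlm f _ If; first by move=> f0; rewrite f0 lm0 in fa.
have lh : lead a h by apply: lead_monic_normal => //; rewrite -fh.
have nsh : nspan (mcle a) (f@_a *: h).
  by apply: nspanZ; apply: (nspan1 nh lh); left.
rewrite -[f](subrK (f@_a *: h)); apply: nspanD nsh.
have low := supp_in_cancel fa lh; set g := f - _ in low *.
have Ig : Id S g.
  rewrite /g -(scaleN1r (_ *: h)); apply: (idealD (Id_ideal S) If).
  by do 2!apply: (idealZ (Id_ideal S)); apply: nspan_Id (nspan1 nh lh I).
have [->|gnz] := pselect (g = 0); first exact: nspan0.
have [b [gb gb0 _]] := lm_max hle gnz; have ba := low b gb0.
apply: nspanW (IHa b ba g Ig gb) => c [->|cb]; right=> //.
exact: (mclt_trans hle cb).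
Qed.

Lemma lm_normal_trivial h : Id_lm_normal -> Id S h -> trivial_mod le S h.
Proof.
move=> Hlm Ih; have [->|nz] := pselect (h = 0).
  exists 0%N, (fun=> 0), (fun=> 0); split=> [|[]//|[]//].
  by rewrite big_ord0.
have [a [ha _ _]] := lm_max hle nz; apply: (nspan_trivial ha).
exact: Id_nspan_lm.
Qed.

(** Reduction modulo S: a leading term that is the leading monomial of a normal
    polynomial is cancelled by it, any other is irreducible and is moved to r.
    The last clause records that no term larger than those of f appears. *)
Lemma reduction f : exists r, [/\ supp_in Irr r, Id S (f - r) &
  forall P, downclosed le P -> supp_in P f -> supp_in P r].
Proof.
have IdI := Id_ideal S.
have [->|nz] := pselect (f = 0).
  exists 0; split=> [||P _ //]; first exact: supp_in0.
  by rewrite subrr; apply: ideal0.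
have [a [fa _ _]] := lm_max hle nz.
elim/(well_founded_ind (mclt_wf hle)): a f nz fa => a IHa f nz fa.
have fa0 := lm_supp hle fa.
have lower g : supp_in (fun b => mclt b a) g ->
    exists r, [/\ supp_in Irr r, Id S (g - r) &
      forall P, downclosed le P -> supp_in P g -> supp_in P r].
  move=> low; have [->|gnz] := pselect (g = 0).
    exists 0; split=> [||P _ //]; first exact: supp_in0.
    by rewrite subrr; apply: ideal0.
  by have [b [gb gb0 _]] := lm_max hle gnz; apply: (IHa b) => //; apply: low.
have downP P h : lead a h -> downclosed le P -> supp_in P f -> supp_in P h.
  move=> /lead_max[_ maxh] dP Pf b /maxh[->|ba]; first exact: Pf.
  by apply: dP ba _; apply: Pf.
have la : lead a (dmon a) by exact: lead_dmon.
have [[h [nh fh]]|irr] := pselect (exists h, normal h /\ lm h = Some a).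
  have lh := lead_monic_normal nh fh.
  have [r [Ir Igr Pr]] := lower _ (supp_in_cancel fa lh).
  exists r; split=> // [|P dP Pf].
    have -> : f - r = f - f@_a *: h - r + f@_a *: h by rewrite addrAC subrK.
    apply: (idealD IdI Igr); apply: (idealZ IdI).
    exact: nspan_Id (nspan1 nh lh I).
  apply: Pr => //; apply: supp_inB => //.
  by apply: supp_inZ; apply: downP lh dP Pf.
have [r [Ir Igr Pr]] := lower _ (supp_in_cancel fa la).
exists (r + f@_a *: dmon a); split=> [||P dP Pf].
- apply: supp_inD => //; apply: supp_inZ; apply: supp_in_dmon => h nh ah.
  by apply: irr; exists h.
- by rewrite [r + _]addrC opprD addrA.
- have Pa := downP P _ la dP Pf; apply: supp_inD; last exact: supp_inZ.
  by apply: Pr => //; apply: supp_inB => //; apply: supp_inZ.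
Qed.

Lemma supp_in_sum_dmon (s : seq (dimon X)) (c : dimon X -> k) :
  supp_in (fun a => a \in s) (\sum_(i <- s) c i *: dmon i : D).
Proof.
elim: s => [|i s IHs]; first by rewrite big_nil; apply: supp_in0.
rewrite big_cons; apply: supp_inD.
  by apply: supp_inZ; apply: supp_in_dmon; rewrite in_cons eqxx.
by apply: supp_inW IHs => a as_; rewrite in_cons as_ orbT.
Qed.

Lemma coeff_sum_dmon (s : seq (dimon X)) (c : dimon X -> k) a : uniq s ->
  a \in s -> (\sum_(i <- s) c i *: dmon i : D)@_a = c a.
Proof.
elim: s => // i s IHs /= /andP[nis us]; rewrite in_cons big_cons mcoeffD coeffZ.
rewrite coeff_dmon; have [<- _|neq /= as_] := eqVneq i a.
  rewrite mulr1; have [->|/supp_in_sum_dmon si] :=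
    eqVneq ((\sum_(j <- s) c j *: dmon j : D)@_i) 0; first by rewrite addr0.
  by rewrite si in nis.
by rewrite mulr0 add0r IHs // -(negPf neq) eq_sym orbF.
Qed.

Lemma dialg_pi_sum (s : seq (dimon X)) (c : dimon X -> k) :
  dialg_pi S (\sum_(i <- s) c i *: dmon i) =
  \sum_(i <- s) c i *: (dialg_pi S (dmon i) : dialg_quot S).
Proof.
elim: s => [|i s IHs]; last first.
  by rewrite !big_cons dialg_pi_add IHs dialg_pi_scaleE.
rewrite !big_nil -(scale0r (0 : D)) -dialg_pi_scaleE scale0r //.
Qed.

Lemma dialg_pi_eq0 f : dialg_pi S f = 0 :> dialg_quot S <-> Id S f.
Proof.
have pi0 : dialg_pi S 0 = 0 :> dialg_quot S.
  by have := dialg_pi_sum [::] (fun=> 0); rewrite !big_nil.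
rewrite -pi0; split=> [/eqP/dialg_piP|If]; first by rewrite subr0.
by apply: dialg_pi_eq; rewrite subr0.
Qed.

(** [reduction] always gives generation. Under (ii) a nonzero combination of
    irreducible elements is not in Id(S), as its leading monomial is one of
    them. Conversely, if the leading monomial a of f in Id(S) is irreducible,
    reducing the tail of f gives an irreducible combination g in Id(S) with a
    nonzero coefficient at a, which contradicts freeness. *)
Lemma lm_normal_basis : Id_lm_normal <->
  is_basis_family (V := dialg_quot S) Irr (fun a => dialg_pi S (dmon a)).
Proof.
split=> [Hlm|[_ free]].
- split=> [v|s c us sIrr /esym/eqP].
    have [r [rIrr Ir _]] := reduction (dialg_repr v).
    exists (msupp r), (fun i => r@_i); split=> [i ir|].
      by apply: rIrr; rewrite mcoeff_neq0.
    rewrite -dialg_pi_sum -dmon_sum -[LHS]dialg_reprK.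
    exact: dialg_pi_eq.
  rewrite -dialg_pi_sum eq_sym => /eqP/dialg_pi_eq0.
  set f := \sum_(i <- s) _ => If.
  have f0 : f = 0.
    apply: contrapT => nz; have [h [nh fh]] := Hlm f nz If.
    have [a [fa fa0 _]] := lm_max hle nz.
    by have /sIrr/(_ h nh) := supp_in_sum_dmon fa0; rewrite -fh fa.
  by move=> i si; rewrite -(coeff_sum_dmon c us si) -/f f0 mcoeff0.
move=> f nz If; apply: contrapT => no_h.
have [a [fa fa0 _]] := lm_max hle nz.
have la : lead a (dmon a) by exact: lead_dmon.
have low := supp_in_cancel fa la.
have [r [rIrr Ir Pr]] := reduction (f - f@_a *: dmon a).
have rlow := Pr _ (mclt_downclosed hle (a := a)) low.
pose g := r + f@_a *: dmon a.
have ga : g@_a != 0.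
  rewrite /g mcoeffD coeffZ coeff_dmon eqxx mulr1.
  have [->|/rlow] := eqVneq (r@_a) 0; first by rewrite add0r.
  by rewrite mcltxx.
have gIrr : supp_in Irr g.
  apply: supp_inD => //; apply: supp_inZ; apply: supp_in_dmon => h nh ah.
  by apply: no_h; exists h; rewrite fa.
have Ig : Id S g.
  have -> : g = f - (f - f@_a *: dmon a - r).
    by rewrite !opprB addrCA subrKC /g.
  rewrite -(scaleN1r (_ - r)); apply: (idealD (Id_ideal S) If).
  exact: (idealZ (Id_ideal S)).
have g0 : g@_a = 0.
  apply: (free (msupp g) (fun i => g@_i)) => //.
  - by move=> i ig; apply: gIrr; rewrite mcoeff_neq0.
  - by rewrite -dialg_pi_sum -dmon_sum; apply/dialg_pi_eq0.
  - by rewrite -mcoeff_neq0.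
by rewrite g0 eqxx in ga.
Qed.

End CompositionDiamond.

Theorem theorem14 (k : fieldType) (d : Order.disp_t) (X : orderType d)
    (le : rel (cword X)) (hle : monomial_order le)
    (S : set (Di k X)) (hS : monic_set le S) :
  (GS_basis le S <->
   (forall f : Di k X, f <> 0%R -> Id S f ->
      exists h : Di k X, normal_S_poly le S h /\ lm le f = lm le h)) /\
  ((forall f : Di k X, f <> 0%R -> Id S f ->
      exists h : Di k X, normal_S_poly le S h /\ lm le f = lm le h) <->
   is_basis_family (V := dialg_quot S) (Irr le S)
     (fun a : dimon X => dialg_pi S (dmon a))).
Proof.
split; last exact: lm_normal_basis.
split=> [[_ GS]|Hlm]; first exact: GS_Id_lm_normal.
split=> // h /composition_Id; exact: lm_normal_trivial.
Qed.
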